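(* Let $q$ be a prime power, $k$ an algebraic closure of $\mathbb{F}_{q^2}$, and $A\in\mathrm{GL}_4(k)$. Let $$d\in\left\{q+1,\ \ q(q+1)\ \text{for}\ 2\mid q,\ \ \tfrac{q(q+1)}{2}\ \text{for}\ 2\nmid q\right\}.$$ Then $$|\mathrm{Aut}(X_A)\backslash\mathcal{T}_d|=\begin{cases}\infty&\text{for } q=2,\\ 1&\text{for } q\ge 3.\end{cases}$$ Especially, when $q\ge3$ the moduli space of $\mathcal{T}_{q+1}$ equals $\{(0,0)\}\subset\mathbb{A}^2$, and those of $\mathcal{T}_{q(q+1)}$ ($q$ even) and $\mathcal{T}_{q(q+1)/2}$ ($q$ odd) equal $\{0\}\subset\mathbb{A}^1$.
   Context: ${}^tM$ denotes the transpose of a matrix $M$; for $M=(m_{i,j})$ over $k$ put $M^{(q)}=(m_{i,j}^q)$. For $A\in\mathrm{GL}_4(k)$, $X_A=\{\boldsymbol{x}\in\mathbb{P}^3 : {}^t\boldsymbol{x}A\boldsymbol{x}^{(q)}=0\}$ (a smooth $k$-Hermitian surface), and $$\mathrm{Aut}(X_A)=\{P\in\mathrm{GL}_4(k) : {}^tPAP^{(q)}=\lambda A,\ \lambda\in k^\times\}/k^\times I .$$ For $F^*\in\mathrm{GL}_4(k)$ and positive integers $d,i,j$ with $1\le i\ne j\le d-1$ and $\gcd(d,i,j)=1$, put $C_{F^*}(d,i,j)=\{F^*\,{}^t(s^d,s^{d-i}t^i,s^{d-j}t^j,t^d)\in\mathbb{P}^3 : {}^t(s,t)\in\mathbb{P}^1\}$.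 $\mathcal{T}_d$ is the set of rational curves $C_d\subset X_A$ of degree $d$ such that, under a suitable choice of the homogeneous coordinates $s,t$ of $\mathbb{P}^1$, $C_d=C_{F^*}(d,i,j)$ for some $F^*\in\mathrm{GL}_4(k)$ and some such $i,j$. The group $\mathrm{Aut}(X_A)$ acts naturally on $\mathcal{T}_d$ (by projective transformations), and the moduli space of $\mathcal{T}_d$ is the space parametrizing the orbit set $\mathrm{Aut}(X_A)\backslash\mathcal{T}_d$; the last assertion says that this orbit set is parametrized by the indicated single point. *)

(* Defs.v *)
From HB Require Import structures.
From mathcomp Require Import all_boot all_order all_algebra.
From mathcomp Require Import boolp classical_sets functions cardinality.
From mathcomp Require Import mpoly.

Set Implicit Arguments.
Unset Strict Implicit.
Unset Printing Implicit Defensive.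

Import GRing.Theory.
Local Open Scope classical_set_scope.
Local Open Scope ring_scope.

Section HermitianSurface.
Variables (k : closedFieldType) (q : nat).

(* Points of P^3(k) are lines through 0 in k^4; the point with homogeneous
   coordinates x is <[x]>. *)
Definition point : Type := {vspace 'cV[k]_4}.
Definition P3 : set point := [set L | \dim L = 1%N].

Definition qpow m n (M : 'M[k]_(m, n)) : 'M[k]_(m, n) :=
  map_mx (fun a : k => a ^+ q) M.

Definition X_ (A : 'M[k]_4) : set point :=
  [set L | P3 L /\ forall x, x \in L -> x^T *m A *m qpow x = 0].

(* Elements of GL_4(k)/k^* are represented as cosets { c P : c in k^* }. *)
Definition scalar_coset (P : 'M[k]_4) : set 'M[k]_4 :=
  [set c *: P | c in [set c : k | c != 0]].

Definition Aut_ (A : 'M[k]_4) : set (set 'M[k]_4) :=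
  [set scalar_coset P | P in
    [set P : 'M[k]_4 | P \in unitmx /\
      exists2 l : k, l != 0 & P^T *m A *m qpow P = l *: A]].

(* All the members of a coset g induce the same map of points. *)
Definition act (g : set 'M[k]_4) (C : set point) : set point :=
  [set (linfun (mulmx P) @: L)%VS | P in g & L in C].

(* The binary form of degree d whose coefficients are the r-th row of M is
   \sum_l M r l s^(d - l) t^l. *)
Definition binary_forms d (M : 'M[k]_(4, d.+1)) (st : k * k) : 'cV[k]_4 :=
  M *m \col_(l < d.+1) (st.1 ^+ (d - l) * st.2 ^+ l).

(* A rational curve of degree d is the image of a morphism
   f : P^1 -> P^3, birational onto its image, given by binary forms of degree d
   without common zeros. Birationality is the existence of a rational map
   (G : H) from the image back to P^1 with (G : H)(f(s, t)) = (s : t) at a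
   general point (s : t). *)
Definition rational_curve (d : nat) (C : set point) : Prop :=
  exists M : 'M[k]_(4, d.+1),
    [/\ forall st, st != (0, 0) -> binary_forms M st != 0,
        exists (e : nat) (G H : {mpoly k[4]}),
          [/\ G \is e.-homog, H \is e.-homog,
              forall st,
                st.1 * H.@[fun r => binary_forms M st r 0]
                = st.2 * G.@[fun r => binary_forms M st r 0]
            & exists st,
                (G.@[fun r => binary_forms M st r 0],
                 H.@[fun r => binary_forms M st r 0]) != (0, 0)]
      & C = [set <[binary_forms M st]>%VS | st in
               [set st : k * k | st != (0, 0)]]].

Definition monomial_vec (d i j : nat) (st : k * k) : 'cV[k]_4 :=
  let: (s, t) := st in
  \col_(r < 4) [:: s ^+ d; s ^+ (d - i) * t ^+ i;
                   s ^+ (d - j) * t ^+ j; t ^+ d]`_r.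

Definition C_ (F : 'M[k]_4) (d i j : nat) : set point :=
  [set <[F *m monomial_vec d i j st]>%VS | st in
     [set st : k * k | st != (0, 0)]].

Definition admissible (d i j : nat) : Prop :=
  [/\ (1 <= i <= d - 1)%N, (1 <= j <= d - 1)%N, i <> j
    & gcdn (gcdn d i) j = 1%N].

(* A change of the coordinates s, t of P^1 does not change the image C. *)
Definition T_ (A : 'M[k]_4) (d : nat) : set (set point) :=
  [set C | [/\ rational_curve d C, C `<=` X_ A
    & exists F i j, [/\ F \in unitmx, admissible d i j & C = C_ F d i j]]].

Definition orbit_ (A : 'M[k]_4) (C : set point) : set (set point) :=
  [set act g C | g in Aut_ A].

Definition orbits (A : 'M[k]_4) (d : nat) : set (set (set point)) :=
  [set orbit_ A C | C in T_ A d].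

End HermitianSurface.

(* Main.v *)
Require Import Defs.
From HB Require Import structures.
From mathcomp Require Import all_boot all_order all_algebra.
From mathcomp Require Import perm finfield ring zify.
From mathcomp Require Import boolp classical_sets functions cardinality.
From mathcomp Require Import mpoly.

(* Put e = (0, i, j, d) and B = F^T A F^(q). The curve C_F(d, i, j) lies on X_A iff,
   for every v, the sum of the B_ab over the cells with e_a + q e_b = v vanishes.
   As B is invertible, every row and column of B meets a cell (a, b) colliding with
   another one, so many differences of exponents are q times other differences;
   for q >= 3 and the given d this determines (i, j) up to the symmetry s <-> t,
   and B up to a few parameters. Reparametrizing the curve, by a torus when
   d <> q + 1 and by GL_2 when d = q + 1, B can be normalized, hence any two such
   curves are exchanged by F' F^-1 in Aut(X_A). The tool is Lang's theorem:
   g^T M g^(Q) = 1 is solvable for every invertible M. It also shows that every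
   B of the right shape occurs.
   For q = 2 there are more collisions, and B can be taken in a one-parameter
   family B_l. A curve of the family determines its parametrization up to
   homographies, which shows that l^3 depends only on the orbit. *)

Set Implicit Arguments.
Unset Strict Implicit.
Unset Printing Implicit Defensive.

Import GRing.Theory.
Local Open Scope classical_set_scope.
Local Open Scope card_scope.
Local Open Scope ring_scope.

(** For d = q + 1 the coordinates are the products of (s, t) with (s^q, t^q). For q >= 3, vanishing
    on the curve makes B alternating in the factor (s^q, t^q), which occurs on both sides. What
    remains is an invertible 2 x 2 matrix N, on which g in GL_2 acts by g^T N g^(q^2) up to a
    scalar, and Lang's theorem for q^2 brings N to 1. In the other degrees two pairs of cells
    survive, and t |-> u t together with a scalar normalizes their two coefficients. The equation
    g^T M g^(Q) = 1 involves a transpose, so fixed vectors of a Q-semilinear map do not solve it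
    directly. Applying the twist twice gives a Q^2-semilinear map, which turns M into a Hermitian
    matrix over the field with Q^2 elements; orthogonalization finishes. Membership in [T_] also
    asks for a rational inverse of the parametrization. Two monomials of equal degree in the
    coordinates whose exponents of t differ by one provide it, and the gcd condition too. For q = 2
    the extra collisions leave an entry l, which the torus elements preserving the other entries
    multiply by cube roots of unity. *)

Section Frobenius.
Variables (k : closedFieldType) (Q : nat) (pQ : [pchar k].-nat Q).

(* The proof argument lets the morphism instances below be inferred. *)
Definition frob_of & [pchar k].-nat Q := fun x : k => x ^+ Q.
Local Notation frob := (frob_of pQ).

Lemma frob_is_zmod_morphism : zmod_morphism frob.
Proof.
move=> x y; rewrite /frob_of exprDn_pchar // -[- y]mulN1r exprMn_comm; last exact: mulrC.
have -> : (-1) ^+ Q = -1 :> k; last by rewrite mulN1r.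
apply/eqP; rewrite -addr_eq0 -[X in _ + X](expr1n _ Q) -exprDn_pchar //.
by rewrite addNr expr0n; case: Q pQ.
Qed.

Lemma frob_is_monoid_morphism : monoid_morphism frob.
Proof. by split=> [|x y]; rewrite /frob_of ?expr1n // exprMn_comm //; exact: mulrC. Qed.

HB.instance Definition _ := GRing.isZmodMorphism.Build k k frob frob_is_zmod_morphism.
HB.instance Definition _ := GRing.isMonoidMorphism.Build k k frob frob_is_monoid_morphism.

Lemma qpowE m n (M : 'M[k]_(m, n)) : qpow Q M = map_mx frob M.
Proof. by []. Qed.

Lemma qpowM m n r (M : 'M[k]_(m, n)) (N : 'M_(n, r)) :
  qpow Q (M *m N) = qpow Q M *m qpow Q N.
Proof. by rewrite !qpowE map_mxM. Qed.

Lemma qpowZ m n c (M : 'M[k]_(m, n)) : qpow Q (c *: M) = c ^+ Q *: qpow Q M.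
Proof. by rewrite !qpowE map_mxZ. Qed.

Lemma qpow1 n : qpow Q (1%:M : 'M[k]_n) = 1%:M.
Proof. by rewrite qpowE map_mx1. Qed.

Lemma qpowD m n (M N : 'M[k]_(m, n)) : qpow Q (M + N) = qpow Q M + qpow Q N.
Proof. by rewrite !qpowE map_mxD. Qed.

Lemma qpow_tr m n (M : 'M[k]_(m, n)) : qpow Q M^T = (qpow Q M)^T.
Proof. by rewrite !qpowE map_trmx. Qed.

Lemma qpow_unit n (M : 'M[k]_n) : (qpow Q M \in unitmx) = (M \in unitmx).
Proof. by rewrite qpowE map_unitmx. Qed.

Lemma qpow_block m1 m2 n1 n2 (A : 'M[k]_(m1, n1)) (B : 'M_(m1, n2))
    (C : 'M_(m2, n1)) (D : 'M_(m2, n2)) :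
  qpow Q (block_mx A B C D)
  = block_mx (qpow Q A) (qpow Q B) (qpow Q C) (qpow Q D).
Proof. by rewrite !qpowE map_block_mx. Qed.

Lemma qpow_delta m n i j : qpow Q (delta_mx i j : 'M[k]_(m, n)) = delta_mx i j.
Proof. by rewrite qpowE map_delta_mx. Qed.

End Frobenius.

(** * Equations over an algebraically closed field *)

Lemma closed_expr (k : closedFieldType) (n : nat) (c : k) :
  (0 < n)%N -> exists x, x ^+ n = c.
Proof.
move=> n0; have /closed_rootP[x] : size ('X^n - c%:P : {poly k}) != 1%N.
  by rewrite size_XnsubC //; case: n n0.
by rewrite rootE !hornerE subr_eq0 => /eqP; exists x.
Qed.

(** If [p] is nonzero, [p * 'X + 1] is not constant, and [p] cannot vanish at a root of it. *)
Lemma infinite_horner_eq0 (k : closedFieldType) (p : {poly k}) :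
  (forall x, p.[x] = 0) -> p = 0.
Proof.
move=> p0; apply/eqP/negPn/negP => np.
have /closed_rootP[x] : size (p * 'X + 1) != 1%N.
  by rewrite size_MXaddC (negPf np) /= eqSS size_poly_eq0.
by rewrite rootE !hornerE p0 mul0r add0r oner_eq0.
Qed.

(** Equations of Artin-Schreier type: with a = -1 they solve the unipotent part of Lang's theorem,
    with a = 1 they give an element of trace one. *)
Lemma exists_root_expD (k : closedFieldType) (Q : nat) (a b : k) :
  (1 < Q)%N -> exists x, x ^+ Q + a * x = b.
Proof.
move=> Q1; have /closed_rootP[x] : size ('X^Q + (a *: 'X - b%:P) : {poly k}) != 1%N.
  rewrite size_polyDl size_polyXn; first by case: Q Q1.
  rewrite ltnS (leq_trans (size_polyD _ _)) // geq_max size_polyN.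
  rewrite (leq_trans (size_scale_leq _ _)) ?size_polyX //.
  by rewrite (leq_trans (size_polyC_leq1 _)) // ltnW.
move/rootP; rewrite !hornerE => x0; exists x.
by apply/eqP; rewrite -subr_eq0 -x0.
Qed.

(** * Lang's theorem and Hermitian forms *)

Section Lang.
Variables (k : closedFieldType) (R : nat) (pR : [pchar k].-nat R).
Hypothesis R_gt1 : (1 < R)%N.

(* If phi is R-semilinear and phi^(m+1) v = sum_i a_i phi^i v, a fixed vector
   sum_(i <= m) c_i phi^i v with c_m = z must have c_i = (krylov_poly a i).[z]. *)
Fixpoint krylov_poly (a : nat -> k) (i : nat) : {poly k} :=
  if i is i'.+1 then krylov_poly a i' ^+ R + a i *: 'X^R else a 0%N *: 'X^R.

(** Writing the polynomial as [T * 'X^2], its nonzero fixed points are the roots of [T * 'X - 1],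
    which exist as soon as [T] is nonzero. *)
Lemma krylov_poly_dvd a i : 'X^2 %| krylov_poly a i.
Proof.
have XR : ('X^2 : {poly k}) %| 'X^R by rewrite dvdp_exp2l.
elim: i => [|i IH] /=; first by rewrite -mul_polyC dvdp_mull.
rewrite dvdp_add // -?mul_polyC ?dvdp_mull //.
by rewrite (dvdp_trans IH) // -{1}[krylov_poly a i]expr1 dvdp_exp2l // ltnW.
Qed.

(** Once nonzero, the polynomial has degree at least [R], so its [R]-th power has degree at least
    [R * R], which the next term in ['X^R] cannot cancel. *)
Lemma krylov_poly_size a i :
  krylov_poly a i = 0 /\ (forall j, (j <= i)%N -> a j = 0)
  \/ (R < size (krylov_poly a i))%N.
Proof.
elim: i => [|i [[P0 a0]|IH]] /=.
- have [a0|a0] := eqVneq (a 0%N) 0; [left|right].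
    by rewrite a0 scale0r; split=> // j; rewrite leqn0 => /eqP->.
  by rewrite size_scale // size_polyXn.
- have R0 : R != 0%N by case: R R_gt1.
  rewrite P0 expr0n (negPf R0) add0r.
  have [ai|ai] := eqVneq (a i.+1) 0; [left|right].
    rewrite ai scale0r; split=> // j.
    by rewrite leq_eqVlt => /orP[/eqP->//|]; apply: a0.
  by rewrite size_scale // size_polyXn.
have sE : (R * R < size (krylov_poly a i ^+ R))%N.
  have P0 : krylov_poly a i ^+ R != 0 by rewrite expf_neq0 // -size_poly_gt0 (leq_trans _ IH).
  move: P0 (size_exp (krylov_poly a i) R) IH; rewrite -size_poly_gt0.
  move: (size (krylov_poly a i ^+ R)) (size (krylov_poly a i)) => x y; nia.
right; rewrite size_polyDl; first by nia.
rewrite (leq_ltn_trans (size_scale_leq _ _)) // size_polyXn; nia.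
Qed.

Lemma krylov_poly_fixpoint a m j : (j <= m)%N -> a j != 0 ->
  exists2 z, z != 0 & (krylov_poly a m).[z] = z.
Proof.
move=> jm aj; have [T PE] := dvdpP _ _ (krylov_poly_dvd a m).
have sP : (R < size (krylov_poly a m))%N.
  by have [[_ /(_ _ jm)/eqP]|//] := krylov_poly_size a m; rewrite (negPf aj).
have T0 : T != 0 by apply: contraTneq sP => T0; rewrite PE T0 mul0r size_poly0.
have /closed_rootP[z] : size (T * 'X - 1) != 1%N.
  by rewrite -[X in _ - X]polyC1 -polyCN size_MXaddC (negPf T0) /= eqSS size_poly_eq0.
rewrite rootE !hornerE subr_eq0 => /eqP Tz.
exists z; first by apply: contra_eq_neq Tz => ->; rewrite mulr0 eq_sym oner_neq0.
by rewrite PE hornerM hornerXn expr2 mulrA Tz mul1r.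
Qed.

(** The newest iterate comes first, so that [free_cons] compares it with the span of the earlier
    ones. *)
Fixpoint krylov n (phi : 'cV[k]_n -> 'cV[k]_n) v m :=
  if m is m'.+1 then iter m' phi v :: krylov phi v m' else [::].

Lemma krylov_spanP n (phi : 'cV[k]_n -> 'cV[k]_n) v m w :
  reflect (exists a : nat -> k, w = \sum_(i < m) a i *: iter i phi v)
          (w \in <<krylov phi v m>>%VS).
Proof.
apply: (iffP idP) => [|[a ->]].
  elim: m w => [|m IH] w /=.
    by rewrite span_nil memv0 => /eqP->; exists (fun=> 0); rewrite big_ord0.
  rewrite span_cons => /memv_addP[_ /vlineP[c ->] [u /IH[a ->] ->]].
  exists (fun i => if i == m then c else a i); rewrite big_ord_recr /= eqxx addrC.
  by congr (_ + _); apply: eq_bigr => i _; rewrite ltn_eqF.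
apply: memv_suml => i _; apply/memvZ/memv_span.
elim: m i => [[]//|m IH] i /=; rewrite inE.
have [im|/eqP im] := eqVneq (i : nat) m; first by rewrite im eqxx.
have lim : (i < m)%N by have := ltn_ord i; lia.
by rewrite (IH (Ordinal lim)) orbT.
Qed.

Lemma krylov_dependent n (phi : 'cV[k]_n -> 'cV[k]_n) v :
  exists m, iter m phi v \in <<krylov phi v m>>%VS.
Proof.
apply: contrapT => no; have fr m : free (krylov phi v m).
  elim: m => [|m IH]; first exact: nil_free.
  by rewrite /= free_cons IH andbT; apply/negP => hm; apply: no; exists m.
have sz m : size (krylov phi v m) = m by elim: m => //= m ->.
have := fr n.+1; rewrite /free sz => /eqP dE.
have := dimvS (subvf <<krylov phi v n.+1>>); rewrite dE dimvf /dim /= muln1; lia.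
Qed.

Lemma semilinear_fixed_vector n (M : 'M[k]_n.+1) : M \in unitmx ->
  exists2 v : 'cV_n.+1, v != 0 & M *m qpow R v = v.
Proof.
move=> uM; pose phi v : 'cV_n.+1 := M *m qpow R v.
pose v0 : 'cV[k]_n.+1 := delta_mx 0 0.
have v0N0 : v0 != 0.
  by apply/eqP => /matrixP/(_ 0 0)/eqP; rewrite !mxE eqxx oner_eq0.
have phi_neq0 v : v != 0 -> phi v != 0.
  apply: contraNneq => /(congr1 (mulmx (invmx M))); rewrite mulKmx // mulmx0.
  by rewrite (qpowE pR) => /eqP; rewrite map_mx_eq0.
have vN0 i : iter i phi v0 != 0 by elim: i => //= i /phi_neq0.
have phiS m (c : nat -> k) (u : nat -> 'cV_n.+1) :
    phi (\sum_(i < m) c i *: u i) = \sum_(i < m) c i ^+ R *: phi (u i).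
  rewrite /phi (qpowE pR) map_mx_sum mulmx_sumr; apply: eq_bigr => i _.
  by rewrite map_mxZ -scalemxAr.
have [m dep min_m] := ex_minnP (krylov_dependent phi v0).
case: m => [|m] in dep min_m; first by rewrite /= span_nil memv0 (negPf (vN0 0%N)) in dep.
have [a aE] := krylov_spanP _ _ _ _ dep.
(* No nonzero vector is killed by [phi], so the relation for the iterate of order m + 1 has a
   nonzero coefficient. *)
have [j jm aj] : exists2 j, (j <= m)%N & a j != 0.
  apply: contrapT => no; have /eqP[] := vN0 m.+1; rewrite aE big1 // => i _.
  have [->|ai] := eqVneq (a i) 0; first by rewrite scale0r.
  by case: no; exists i => //; rewrite -ltnS.
have [z z0 Pz] := krylov_poly_fixpoint jm aj.
pose c i := (krylov_poly a i).[z].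
exists (\sum_(i < m.+1) c i *: iter i phi v0).
  (* The last coefficient is z, so a zero sum would put the iterate of order m in the span of the
     earlier ones, against the minimality of m + 1. *)
  apply/eqP; rewrite big_ord_recr /= {2}/c Pz => w0.
  have : iter m phi v0 \in <<krylov phi v0 m>>%VS.
    have -> : iter m phi v0 = - z^-1 *: \sum_(i < m) c i *: iter i phi v0.
      move/eqP: w0; rewrite addr_eq0 => /eqP ->.
      by rewrite scalerN scaleNr opprK scalerA mulVf // scale1r.
    by apply/memvZ/krylov_spanP; exists c.
  by move/min_m; rewrite ltnn.
have cm : c m = z := Pz.
(* Coefficients are compared along an abstract sequence [w] of iterates: c_0 = a_0 z^R and c_(i+1) =
   c_i^R + a_(i+1) z^R, which is the recursion of [krylov_poly] evaluated at z. *)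
suff phi_fix w : (forall i, phi (w i) = w i.+1) ->
    w m.+1 = \sum_(i < m.+1) a i *: w i ->
    phi (\sum_(i < m.+1) c i *: w i) = \sum_(i < m.+1) c i *: w i.
  exact: (phi_fix (fun i => iter i phi v0)).
move=> phiw wE; rewrite (phiS _ c w) big_ord_recr /= phiw wE cm scaler_sumr.
rewrite [X in _ + X]big_ord_recl [RHS]big_ord_recl /= addrCA -big_split /=.
congr (_ + _); first by rewrite scalerA /c /= !hornerE mulrC.
apply: eq_bigr => i _; rewrite phiw scalerA -scalerDl /c /= !hornerE.
by rewrite [z ^+ R * _]mulrC.
Qed.

End Lang.

Lemma unitmx_first_col (K : fieldType) n (v : 'cV[K]_n.+1) : v != 0 ->
  exists2 g : 'M_n.+1, g \in unitmx & g *m delta_mx 0 0 = v.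
Proof.
move=> vN0; have rv : \rank v = 1%N.
  by apply/eqP; rewrite eqn_leq rank_leq_col lt0n mxrank_eq0.
have := mulmx_ebase v; rewrite rv => vE.
pose c := row_ebase v 0 0.
have rE : row_ebase v = c%:M by apply/matrixP => i j; rewrite !ord1 !mxE eqxx mulr1n.
have cN0 : c != 0.
  by have := row_ebase_unit v; rewrite unitmxE rE det_scalar1 unitfE.
exists (c *: col_ebase v).
  by rewrite unitmxZ ?unitfE // col_ebase_unit.
rewrite -[RHS]vE rE mul_mx_scalar -scalemxAl.
congr (_ *: (_ *m _)).
by apply/matrixP => i j; rewrite !ord1 !mxE eqxx andbT -val_eqE /= ltnS leqn0 andb_idr // => /eqP->.
Qed.

Lemma block_of_fixed_delta (K : fieldType) n (N : 'M[K]_(1 + n)) :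
  N *m delta_mx 0 0 = (delta_mx 0 0 : 'cV_(1 + n)) ->
  N = block_mx 1%:M (ursubmx N) 0 (drsubmx N).
Proof.
rewrite -colE => /colP N0; rewrite -[LHS]submxK; congr block_mx.
  by apply/matrixP => i j; have := N0 (lshift n 0); rewrite !mxE !ord1 lshift0 => ->.
apply/matrixP => i j; have := N0 (rshift 1 i); rewrite !mxE !ord1 lshift0 => -> //.
Qed.

Section LangTorsor.
Variables (k : closedFieldType) (R : nat) (pR : [pchar k].-nat R).
Hypothesis R_gt1 : (1 < R)%N.

(** Taking a fixed vector as first basis vector makes the matrix block triangular with corner 1.
    Induction solves the lower block, and the remaining row x solves x^R - x = -b entry by entry. *)
Lemma semilinear_torsor n (M : 'M[k]_n) : M \in unitmx ->
  exists2 g : 'M_n, g \in unitmx & M *m qpow R g = g.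
Proof.
elim: n M => [|n IH] M uM.
  by exists 1%:M; [exact: unitmx1 | apply/matrixP => -[]].
have [v vN0 vE] := semilinear_fixed_vector pR R_gt1 uM.
have [g0 ug0 g0E] := unitmx_first_col vN0.
pose N : 'M_(1 + n) := invmx g0 *m M *m qpow R g0.
have uN : N \in unitmx by rewrite !unitmx_mul unitmx_inv ug0 uM qpow_unit.
have /block_of_fixed_delta NE : N *m delta_mx 0 0 = (delta_mx 0 0 : 'cV_(1 + n)).
  by rewrite /N -!mulmxA -[X in _ *m (_ *m (_ *m X))](qpow_delta pR) -(qpowM pR) g0E vE -g0E mulKmx.
have uD : drsubmx N \in unitmx.
  by move: uN; rewrite NE !unitmxE det_ublock det1 mul1r block_mxKdr.
have [h uh hE] := IH _ uD.
pose b := ursubmx N *m qpow R h.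
have /choice[x xE] : forall j, exists y, y ^+ R + (-1) * y = - b 0 j.
  by move=> j; apply: exists_root_expD.
pose H : 'M_(1 + n) := block_mx 1%:M (\row_j x j) 0 h.
have HE : N *m qpow R H = H.
  rewrite NE (qpow_block pR) mulmx_block !(qpowE pR) map_mx1 map_mx0.
  rewrite !mulmx0 !mul0mx !mul1mx !addr0 !add0r hE; congr block_mx.
  apply/rowP => j; have /eqP := xE j; rewrite mulN1r subr_eq => /eqP xjE.
  rewrite -[X in _ + X]/b; clearbody b.
  by rewrite !mxE [frob_of _ _]xjE addrAC addNr add0r.
exists (g0 *m H); first by rewrite unitmx_mul ug0 [H \in _]unitmxE det_ublock det1 mul1r -unitmxE.
by rewrite (qpowM pR) -[in RHS]HE /N !mulmxA mulmxV // mul1mx.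
Qed.

End LangTorsor.

Section HermitianForms.
Variables (k : closedFieldType) (Q : nat) (pQ : [pchar k].-nat Q).
Hypothesis Q_gt1 : (1 < Q)%N.

Lemma qpow_comp m n (M : 'M[k]_(m, n)) : qpow Q (qpow Q M) = qpow (Q * Q) M.
Proof. by apply/matrixP => i j; rewrite !mxE exprM. Qed.

(* The columns of g are fixed by the Q^2-semilinear map x |-> A^-T A^(Q) x^(Q^2). *)
Lemma hermitian_form n (A : 'M[k]_n) : A \in unitmx ->
  exists2 g : 'M_n, g \in unitmx &
    let S := g^T *m A *m qpow Q g in qpow Q S = S^T.
Proof.
move=> uA; have uAT : A^T \in unitmx by rewrite unitmx_tr.
have pQ2 : [pchar k].-nat (Q * Q)%N by rewrite pnatM pQ.
have [||g ug gE] := @semilinear_torsor _ _ pQ2 _ _ (invmx A^T *m qpow Q A).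
- nia.
- by rewrite unitmx_mul unitmx_inv uAT qpow_unit.
exists g => //=; rewrite !(qpowM pQ) !trmx_mul trmxK -!(qpow_tr pQ) -mulmxA; congr (_ *m _).
by rewrite qpow_comp -{2}gE !mulmxA mulmxV // mul1mx.
Qed.

(* At a zero diagonal, S i j != 0 is detected by e_i + c e_j, with c a multiple
   of S i j by an element y of F_(Q^2) of trace y^Q + y = 1. *)
Lemma hermitian_anisotropic n (S : 'M[k]_n.+1) : S \in unitmx -> qpow Q S = S^T ->
  exists2 x : 'cV_n.+1, qpow Q (qpow Q x) = x & (x^T *m S *m qpow Q x) 0 0 != 0.
Proof.
move=> uS SE; have sE i j : S i j ^+ Q = S j i.
  by move/matrixP: SE => /(_ i j); rewrite !mxE.
pose e (i : 'I_n.+1) : 'cV[k]_n.+1 := delta_mx i 0.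
have eQ i : qpow Q (e i) = e i by exact: qpow_delta.
have eSe i j : (e i)^T *m S *m e j = (S i j)%:M.
  apply/matrixP => a b; rewrite !ord1 -mulmxA -colE trmx_delta -rowE !mxE.
  by rewrite mulr1n.
have [[i Si]|no] := pselect (exists i, S i i != 0).
  by exists (e i); rewrite !eQ // eSe mxE mulr1n.
have S0 i : S i i = 0 by apply/eqP/negPn/negP => Si; apply: no; exists i.
have [[i [j Sij]]|no2] := pselect (exists i j, S i j != 0); last first.
  have S00 : S = 0.
    apply/matrixP => i j; rewrite !mxE; apply/eqP/negPn/negP => Si.
    by apply: no2; exists i, j.
  by move: uS; rewrite S00 unitmxE det0 unitr0.
have [y yE] := exists_root_expD (1 : k) 1 Q_gt1.
have yQ : y ^+ Q = 1 - y by rewrite -yE mul1r addrK.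
have yQQ : (y ^+ Q) ^+ Q = y.
  rewrite yQ -[LHS]/(frob_of pQ _) rmorphB rmorph1 /= [frob_of _ _]yQ; ring.
set u := S i j in Sij *.
exists (e i + (y * u) *: e j).
  rewrite !((qpowD pQ), (qpowZ pQ)) !eQ; congr (_ + _ *: _).
  by rewrite !exprMn yQQ /u !sE.
rewrite (qpowD pQ) (qpowZ pQ) !eQ.
have -> : (e i + (y * u) *: e j)^T = (e i)^T + (y * u) *: (e j)^T.
  by rewrite linearD linearZ.
rewrite !(mulmxDl, mulmxDr) -!(scalemxAl, scalemxAr) !eSe !S0 !mxE !eqxx !mulr1n.
rewrite -/u -[S j i]sE -/u !mulr0 addr0 add0r.
have -> : y * u * u ^+ Q + (y * u) ^+ Q * u = u ^+ Q * u.
  rewrite exprMn yQ; ring.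
by rewrite mulf_neq0 // expf_neq0.
Qed.

(** Gram-Schmidt, with each induction step first passing to a Hermitian matrix. The complementary
    block [D] need not be Hermitian, which is why the induction runs over all invertible
    matrices. *)
Lemma hermitian_diagonalization n (A : 'M[k]_n) : A \in unitmx ->
  exists2 g : 'M_n, g \in unitmx & g^T *m A *m qpow Q g = 1%:M.
Proof.
elim: n A => [|n IH] A uA.
  by exists 1%:M; [exact: unitmx1 | apply/matrixP => -[]].
have [g ug /=] := hermitian_form uA; move SD : (_ *m _ *m _ : 'M_(1 + n)) => S SE.
have uS : S \in unitmx by rewrite -SD !unitmx_mul unitmx_tr (qpow_unit pQ) ug uA.
have [x xE xSx] := hermitian_anisotropic uS SE.
have xN0 : x != 0.
  apply: contraNneq xSx => ->; by rewrite trmx0 !mul0mx mxE.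
have [g0 ug0 g0E] := unitmx_first_col xN0.
move A1D : (g0^T *m S *m qpow Q g0 : 'M_(1 + n)) => A1.
have uA1 : A1 \in unitmx.
  by rewrite -A1D !unitmx_mul !unitmx_tr !(qpow_unit pQ) ug0 uS.
pose h := A1 0 0; pose s := dlsubmx A1.
pose e0 : 'cV[k]_(1 + n) := delta_mx 0 0.
have e0Q : qpow Q e0 = e0 by exact: qpow_delta.
have e0E : g0 *m e0 = x by exact: g0E.
have A1col : A1 *m e0 = g0^T *m S *m qpow Q x.
  by rewrite -A1D -e0E (qpowM pQ) e0Q !mulmxA.
have A1row : e0^T *m A1 = x^T *m S *m qpow Q g0.
  by rewrite -A1D -e0E trmx_mul !mulmxA.
(* The entries of [g0] lie in k, so [A1] need not be Hermitian. Its first row and column are still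
   conjugate, because the first column x of [g0] is fixed by the Q^2-power map. *)
have A1Q i : A1 i 0 ^+ Q = A1 0 i.
  have : qpow Q (A1 *m e0) = (e0^T *m A1)^T.
    by rewrite A1col A1row !(qpowM pQ) xE SE (qpow_tr pQ) !trmx_mul trmxK mulmxA.
  by rewrite -colE trmx_delta -rowE => /colP/(_ i); rewrite !mxE.
have hE : h != 0.
  have -> : h = (e0^T *m A1 *m e0) 0 0 by rewrite trmx_delta -colE -rowE !mxE.
  by rewrite A1row -[X in _ *m X]e0Q -[_ *m qpow Q g0 *m _]mulmxA -(qpowM pQ) e0E.
(* Scaling the first basis vector by l multiplies its value h by l^(Q+1). The other columns of [U]
   subtract multiples of it that clear the first row and the first column at once, since h^Q = h. *)
have [l lE] : exists l, l ^+ Q.+1 = h^-1 by exact: closed_expr.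
pose U : 'M_(1 + n) := block_mx l%:M (- (h^-1 *: s^T)) 0 1%:M.
have lN0 : l != 0.
  by apply/eqP => l0; move: lE; rewrite l0 expr0n => /esym/eqP; rewrite invr_eq0 (negPf hE).
have uU : U \in unitmx by rewrite unitmxE det_ublock det_scalar1 det1 mulr1 unitfE.
pose D := drsubmx A1 - h^-1 *: (s *m ursubmx A1).
have UE : U^T *m A1 *m qpow Q U = block_mx 1%:M 0 0 D.
  have A1E : A1 = block_mx h%:M (qpow Q s)^T s (drsubmx A1).
    rewrite -[LHS]submxK; congr block_mx; apply/matrixP => i j.
      by rewrite !ord1 !mxE lshift0 eqxx mulr1n.
    by have := A1Q (rshift 1 j); rewrite !ord1 !mxE !lshift0 => <-.
  have hQ : h ^+ Q = h by exact: A1Q.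
  have ursE : ursubmx A1 = (qpow Q s)^T by rewrite {1}A1E block_mxKur.
  rewrite /D ursE A1E /U tr_block_mx (qpow_block pQ) !mulmx_block block_mxKdr.
  rewrite !(trmx0, tr_scalar_mx, trmx1, qpow1 pQ).
  have -> : qpow Q (0 : 'M[k]_(n, 1)) = 0 by rewrite (qpowE pQ) map_mx0.
  have -> : qpow Q (l%:M : 'M[k]_1) = (l ^+ Q)%:M by rewrite (qpowE pQ) map_scalar_mx.
  rewrite !(mul0mx, mulmx0, mul1mx, mulmx1, add0r, addr0, mul_scalar_mx, mul_mx_scalar).
  have -> : (- (h^-1 *: s^T))^T = - (h^-1 *: s) by rewrite linearN linearZ /= trmxK.
  have -> : h *: - (h^-1 *: s) + s = 0 by rewrite scalerN scalerA mulfV // scale1r addNr.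
  have -> : qpow Q (- (h^-1 *: s^T)) = - (h^-1 *: (qpow Q s)^T).
    rewrite -(qpow_tr pQ) !(qpowE pQ) map_mxN map_mxZ /=.
    by rewrite [frob_of _ _](exprVn h Q) hQ.
  rewrite mul0mx scaler0 add0r -scalemxAl mul_scalar_mx -scalerDr scalerN [h *: _]scalerA.
  rewrite mulfV // scale1r addNr scaler0 mulNmx -scalemxAl addrC.
  by congr block_mx; rewrite !scale_scalar_mx mulrA -exprSr lE mulVf //.
have uD : D \in unitmx.
  have : U^T *m A1 *m qpow Q U \in unitmx.
    by rewrite !unitmx_mul unitmx_tr (qpow_unit pQ) uU uA1.
  by rewrite UE !unitmxE det_ublock det1 mul1r.
have [w uw wE] := IH D uD.
pose W : 'M_(1 + n) := block_mx 1%:M 0 0 w.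
have uW : W \in unitmx by rewrite unitmxE det_ublock det1 mul1r -unitmxE.
exists (g *m g0 *m U *m W).
  by rewrite !unitmx_mul ug ug0 uU uW.
have -> : (g *m g0 *m U *m W)^T *m A *m qpow Q (g *m g0 *m U *m W)
          = W^T *m (U^T *m A1 *m qpow Q U) *m qpow Q W.
  by rewrite !(qpowM pQ) !trmx_mul -A1D -SD !mulmxA.
rewrite UE tr_block_mx (qpow_block pQ) !(qpowE pQ) !mulmx_block !map_mx1 !map_mx0 !trmx0 trmx1.
rewrite !(mulmx0, mul0mx, mul1mx, mulmx1, addr0, add0r) -(qpowE pQ) wE.
by rewrite -scalar_mx_block.
Qed.

End HermitianForms.

(** * Monomial curves on Hermitian surfaces *)

(** Both forms are congruent to the identity. With [B] a prescribed normal form, this produces the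
    curves on the surface. *)
Lemma qform_congruent (k : closedFieldType) (q n : nat) (A B : 'M[k]_n) :
  [pchar k].-nat q -> (1 < q)%N -> A \in unitmx -> B \in unitmx ->
  exists2 F : 'M_n, F \in unitmx & F^T *m A *m qpow q F = B.
Proof.
move=> pq q1 uA uB; have [f uf fE] := hermitian_diagonalization pq q1 uA.
have [g ug gE] := hermitian_diagonalization pq q1 uB.
exists (f *m invmx g); first by rewrite unitmx_mul unitmx_inv uf.
have -> : (f *m invmx g)^T *m A *m qpow q (f *m invmx g)
          = (invmx g)^T *m (f^T *m A *m qpow q f) *m qpow q (invmx g).
  by rewrite (qpowM pq) trmx_mul !mulmxA.
rewrite fE -gE !mulmxA -trmx_mul mulmxV // trmx1 mul1mx -mulmxA -(qpowM pq).
by rewrite mulmxV // (qpow1 pq) mulmx1.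
Qed.

Definition o0 : 'I_4 := @Ordinal 4 0 isT.
Definition o1 : 'I_4 := @Ordinal 4 1 isT.
Definition o2 : 'I_4 := @Ordinal 4 2 isT.
Definition o3 : 'I_4 := @Ordinal 4 3 isT.

Lemma ord4_ind (P : 'I_4 -> Prop) : P o0 -> P o1 -> P o2 -> P o3 -> forall r, P r.
Proof.
move=> P0 P1 P2 P3 [[|[|[|[|//]]]] lt_r].
- by rewrite (_ : Ordinal _ = o0) //; apply: val_inj.
- by rewrite (_ : Ordinal _ = o1) //; apply: val_inj.
- by rewrite (_ : Ordinal _ = o2) //; apply: val_inj.
by rewrite (_ : Ordinal _ = o3) //; apply: val_inj.
Qed.

Lemma sum_ord4 (V : nmodType) (f : 'I_4 -> V) :
  \sum_(r < 4) f r = f o0 + f o1 + f o2 + f o3.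
Proof.
rewrite !big_ord_recr big_ord0 /= add0r.
by congr (f _ + f _ + f _ + f _); apply: val_inj.
Qed.

Definition mx4 (k : closedFieldType) (rows : seq (seq k)) : 'M[k]_4 :=
  \matrix_(a, b) (nth [::] rows a)`_b.

Definition expo (d i j : nat) (r : 'I_4) : nat := nth 0%N [:: 0%N; i; j; d] r.

Section Curves.
Variables (k : closedFieldType) (q : nat) (pq : [pchar k].-nat q).

Lemma monomial_vecE d i j (st : k * k) : (i <= d)%N -> (j <= d)%N ->
  monomial_vec d i j st
  = \col_r (st.1 ^+ (d - expo d i j r) * st.2 ^+ expo d i j r).
Proof.
case: st => s t id jd; apply/colP; elim/ord4_ind; rewrite !mxE /expo /=.
- by rewrite mulr1 subn0.
- by [].
- by [].
by rewrite subnn mul1r.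
Qed.

Lemma monomial_vec_neq0 d i j (st : k * k) : st != (0, 0) -> monomial_vec d i j st != 0.
Proof.
case: st => s t st0; apply/eqP => /colP x0; have := x0 o0; have := x0 o3.
rewrite !mxE /= => /eqP; rewrite expf_eq0 => /andP[_ /eqP t0].
move/eqP; rewrite expf_eq0 => /andP[_ /eqP s0].
by rewrite s0 t0 eqxx in st0.
Qed.

Lemma C_subX A (F : 'M[k]_4) d i j : F \in unitmx ->
  C_ F d i j `<=` X_ q A <->
  (forall st, st != (0, 0) ->
     (monomial_vec d i j st)^T *m (F^T *m A *m qpow q F)
       *m qpow q (monomial_vec d i j st) = 0).
Proof.
move=> uF; have FE x : (F *m x)^T *m A *m qpow q (F *m x)
    = x^T *m (F^T *m A *m qpow q F) *m qpow q x :> 'M[k]_1.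
  by rewrite (qpowM pq) trmx_mul !mulmxA.
split=> [sub st st0|van _ [st st0 <-]].
  have [|_ /(_ (F *m monomial_vec d i j st))] := sub <[F *m monomial_vec d i j st]>%VS.
    by exists st.
  by rewrite FE => ->//; exact: memv_line.
split.
  rewrite /P3 /= dim_vline; case: eqP => // Fx0.
  have := monomial_vec_neq0 d i j st0.
  by rewrite -[monomial_vec _ _ _ _](mulKmx uF) Fx0 mulmx0 eqxx.
move=> _ /vlineP[c ->]; rewrite linearZ (qpowZ pq) /= -!scalemxAl -scalemxAr FE.
by rewrite van // !scaler0.
Qed.

Definition cell_sums d i j (B : 'M[k]_4) : Prop := forall v,
  \sum_a \sum_b (if (expo d i j a + q * expo d i j b == v)%N then B a b else 0) = 0.

Lemma monomial_form d i j (B : 'M[k]_4) st : (i <= d)%N -> (j <= d)%N ->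
  ((monomial_vec d i j st)^T *m B *m qpow q (monomial_vec d i j st)) 0 0
  = \sum_a \sum_b B a b *
      (st.1 ^+ (d + q * d - (expo d i j a + q * expo d i j b))
       * st.2 ^+ (expo d i j a + q * expo d i j b)).
Proof.
move=> id jd; have le_d a : (expo d i j a <= d)%N by elim/ord4_ind: a.
rewrite mxE [RHS]exchange_big; apply: eq_bigr => b _.
rewrite mxE mulr_suml; apply: eq_bigr => a _.
rewrite monomial_vecE // !mxE.
have -> : (d + q * d - (expo d i j a + q * expo d i j b)
           = (d - expo d i j a) + q * (d - expo d i j b))%N.
  by have := le_d a; have := le_d b; nia.
rewrite !exprD !exprM exprMn -!exprM ![(q * _)%N]mulnC; ring.
Qed.

Lemma cell_sumsP d i j (B : 'M[k]_4) : (i <= d)%N -> (j <= d)%N ->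
  cell_sums d i j B <->
  (forall st, st != (0, 0) ->
     (monomial_vec d i j st)^T *m B *m qpow q (monomial_vec d i j st) = 0).
Proof.
move=> id jd; split=> [B0 st _|van v].
  apply/matrixP => a b; rewrite !ord1 monomial_form // mxE.
  rewrite pair_big /=.
  (* The monomials are grouped by their exponent of t. It is at most d + q d, so [inord] never falls
     back to its default. *)
  pose val (p : 'I_4 * 'I_4) : 'I_(d + q * d).+1 :=
    inord (expo d i j p.1 + q * expo d i j p.2).
  have valE p : val p = (expo d i j p.1 + q * expo d i j p.2)%N :> nat.
    rewrite inordK // ltnS.
    have le_d r : (expo d i j r <= d)%N by elim/ord4_ind: r.
    by have := le_d p.1; have := le_d p.2; nia.
  rewrite (partition_big val predT) //= big1 // => v _.
  have /(congr1 ( *%R^~ (st.1 ^+ (d + q * d - v) * st.2 ^+ v))) := B0 v.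
  rewrite /= mul0r pair_big /= mulr_suml => vE.
  rewrite -[RHS]vE [LHS]big_mkcond /=; apply: eq_bigr => p _.
  by rewrite -val_eqE /= valE; case: eqP => [<-|]; rewrite ?mul0r.
pose P : {poly k} := \sum_a \sum_b B a b *: 'X^(expo d i j a + q * expo d i j b).
have P0 : P = 0.
  apply: infinite_horner_eq0 => t.
  have st0 : (1, t) != (0, 0) :> k * k by rewrite xpair_eqE oner_eq0.
  have /matrixP/(_ 0 0) := van _ st0; rewrite monomial_form // mxE => E; rewrite -[RHS]E.
  rewrite horner_sum; apply: eq_bigr => a _; rewrite horner_sum; apply: eq_bigr => b _.
  by rewrite hornerZ hornerXn expr1n mul1r.
have /(congr1 (coefp v)) := P0; rewrite /= coef0 => E; rewrite -[RHS]E.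
rewrite coef_sum; apply: eq_bigr => a _; rewrite coef_sum; apply: eq_bigr => b _.
by rewrite coefZ coefXn eq_sym; case: eqP; rewrite ?mulr1 ?mulr0.
Qed.

Lemma isolated_cell d i j (B : 'M[k]_4) a b : cell_sums d i j B ->
  (forall a' b', (expo d i j a' + q * expo d i j b' = expo d i j a + q * expo d i j b)%N ->
     a' = a /\ b' = b) ->
  B a b = 0.
Proof.
move=> B0 iso; rewrite -[RHS](B0 (expo d i j a + q * expo d i j b)%N).
rewrite pair_big (bigD1 (a, b)) //= eqxx big1 ?addr0 // => -[a' b'] /= n.
by case: eqP => // /iso[E1 E2]; rewrite E1 E2 eqxx in n.
Qed.

Lemma paired_cells d i j (B : 'M[k]_4) a b c e : cell_sums d i j B ->
  (expo d i j a + q * expo d i j b = expo d i j c + q * expo d i j e)%N ->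
  a != c ->
  (forall a' b', (expo d i j a' + q * expo d i j b' = expo d i j a + q * expo d i j b)%N ->
     (a', b') = (a, b) \/ (a', b') = (c, e)) ->
  B c e = - B a b.
Proof.
move=> B0 E ac iso; apply/eqP; rewrite -addr_eq0 addrC; apply/eqP.
rewrite -[RHS](B0 (expo d i j a + q * expo d i j b)%N) pair_big /=.
rewrite (bigD1 (a, b)) //= (bigD1 (c, e)) /=; last first.
  by rewrite xpair_eqE negb_and eq_sym ac.
rewrite -E eqxx big1 ?addr0 // => -[a' b'] /= /andP[n1 n2].
by case: eqP => // /iso[] E'; rewrite E' eqxx in n1 n2.
Qed.

End Curves.

(** * Exponents *)

Lemma expoE d i j : (expo d i j o0 = 0%N) * (expo d i j o1 = i)
  * (expo d i j o2 = j) * (expo d i j o3 = d).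
Proof. by []. Qed.

Lemma expo_le d i j a : (i < j)%N -> (j < d)%N -> (expo d i j a <= d)%N.
Proof. by move=> ij jd; elim/ord4_ind: a; rewrite ?expoE; lia. Qed.

Lemma expo_inj d i j : (0 < i)%N -> (i < j)%N -> (j < d)%N -> injective (expo d i j).
Proof.
by move=> i0 ij jd; elim/ord4_ind; elim/ord4_ind => //; rewrite !expoE; lia.
Qed.

Section Collisions.
Variables (k : closedFieldType) (q d i j : nat) (B : 'M[k]_4).
Hypotheses (uB : B \in unitmx) (sumB : cell_sums q d i j B).
Local Notation e := (expo d i j).

Lemma column_collision b : exists a a' b',
  (a', b') <> (a, b) /\ (e a' + q * e b' = e a + q * e b)%N.
Proof.
apply: contrapT => no; have B0 a : B a b = 0.
  apply: (isolated_cell sumB) => a' b' E.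
  have [[-> ->]//|n] := pselect ((a', b') = (a, b)).
  by case: no; exists a, a', b'.
have /(congr1 (mulmx (invmx B))) : B *m delta_mx b 0 = 0 :> 'cV_4.
  by rewrite -colE; apply/colP => a; rewrite !mxE B0.
rewrite mulKmx // mulmx0 => /colP/(_ b)/eqP.
by rewrite !mxE !eqxx oner_eq0.
Qed.

Lemma row_collision a : exists b a' b',
  (a', b') <> (a, b) /\ (e a' + q * e b' = e a + q * e b)%N.
Proof.
apply: contrapT => no; have B0 b : B a b = 0.
  apply: (isolated_cell sumB) => a' b' E.
  have [[-> ->]//|n] := pselect ((a', b') = (a, b)).
  by case: no; exists b, a', b'.
have /(congr1 (mulmx^~ (invmx B))) : delta_mx 0 a *m B = 0 :> 'rV_4.
  by rewrite -rowE; apply/rowP => b; rewrite !mxE B0.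
rewrite mulmxK // mul0mx => /rowP/(_ a)/eqP.
by rewrite !mxE !eqxx oner_eq0.
Qed.

Hypotheses (q_gt1 : (1 < q)%N) (i_gt0 : (0 < i)%N) (ij : (i < j)%N) (jd : (j < d)%N).

(** Column [o0] has weight 0, so a collision in it makes a difference of two exponents equal to q
    times an exponent; q * 0 would give equal rows and q * d is too large. [last_column] is the
    mirror image under s <-> t. *)
Lemma first_column : exists a a' b,
  [/\ b = o1 \/ b = o2, a' <> a & e a' + q * e b = e a]%N.
Proof.
have [a [a' [b [n]]]] := column_collision o0; rewrite expoE muln0 addn0 => E.
have aa' : a' <> a.
  move=> aa'; apply: n; rewrite aa' in E *; congr (_, _).
  by apply: (expo_inj i_gt0 ij jd); rewrite expoE; nia.
exists a, a', b; split=> //; move: E (expo_le a ij jd).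
elim/ord4_ind: b n => n E ae; [|by left|by right|].
- by case: aa'; apply: (expo_inj i_gt0 ij jd); move: E; rewrite expoE muln0 addn0.
have : (d < q * d)%N by nia.
by move: E; rewrite expoE; lia.
Qed.

Lemma last_column : exists a a' b,
  [/\ b = o1 \/ b = o2, a' <> a & e a' + q * (d - e b) = e a]%N.
Proof.
have [a [a' [b [n]]]] := column_collision o3; rewrite expoE => E.
have bd := expo_le b ij jd.
have aa' : a <> a'.
  move=> aa'; apply: n; rewrite aa' in E *; congr (_, _).
  by apply: (expo_inj i_gt0 ij jd); rewrite expoE; nia.
exists a', a, b; split=> //; last by move: E bd; rewrite mulnBr; nia.
move: E bd (expo_le a' ij jd); elim/ord4_ind: b n => n E bd ae; [|by left|by right|].
- have : (d < q * d)%N by nia.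
  by move: E; rewrite expoE; lia.
by case: aa'; apply: (expo_inj i_gt0 ij jd); move: E; rewrite expoE; lia.
Qed.

Lemma row_congruence a : exists2 a', a' <> a & e a' = e a %[mod q].
Proof.
have [b [a' [b' [n E]]]] := row_collision a.
exists a'; last first.
  by rewrite -(modnMDl (e b') (e a')) -(modnMDl (e b) (e a)) addnC mulnC E addnC mulnC.
move=> aa'; apply: n; rewrite aa' in E *; congr (_, _).
have {}E : e b' = e b by nia.
by move: E; elim/ord4_ind: b; elim/ord4_ind: b'; rewrite /expo //=; lia.
Qed.

End Collisions.

Lemma multiple_in_range q x : (2 < q)%N -> (0 < x <= 2 * q + 2)%N -> (q %| x)%N ->
  x = q \/ x = (2 * q)%N.
Proof.
move=> q2 /andP[x0 xq] /dvdnP[m xE]; subst x.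
have : m = 1%N \/ m = 2%N by nia.
by case=> ->; lia.
Qed.

(** Used with x = i and y = d - j, and with the roles exchanged. The five equations say that q x is
    one of the differences of 0, i, j, d other than x; those involving y reduce to bounds or to
    divisibility of y or x + y by q. *)
Lemma difference_even q x y : (2 < q)%N -> (0 < x <= q + 1)%N -> (0 < y <= q + 1)%N ->
  let d := (q * (q + 1))%N in
  (q * x = y \/ q * x = d \/ q * x + x + y = d \/ q * x + x = d \/ q * x + y = d)%N ->
  (x = q + 1 \/ x = q \/ x + 1 = q /\ y = q + 1 \/ x = 1 /\ y = q)%N.
Proof.
move=> q2 /andP[x0 xq] /andP[y0 yq] d [|[|[|[|]]]]; rewrite /d => E.
- have : x = 1%N by nia.
  lia.
- left; nia.
- have dv : (q %| x + y)%N by apply/dvdnP; exists (q + 1 - x)%N; nia.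
  have rg : (0 < x + y <= 2 * q + 2)%N by lia.
  by case: (multiple_in_range q2 rg dv) => ?; nia.
- right; left; nia.
have dv : (q %| y)%N by apply/dvdnP; exists (q + 1 - x)%N; nia.
have rg : (0 < y <= 2 * q + 2)%N by lia.
  by case: (multiple_in_range q2 rg dv) => ?; nia.
Qed.

(** Of the eight pairs that meet the condition in both directions, only the first two are realized;
    they are exchanged by s <-> t. *)
Lemma difference_even_sym q x y : (2 < q)%N ->
  (x = q + 1 \/ x = q \/ x + 1 = q /\ y = q + 1 \/ x = 1 /\ y = q)%N ->
  (y = q + 1 \/ y = q \/ y + 1 = q /\ x = q + 1 \/ y = 1 /\ x = q)%N ->
  (x + 1 = q /\ y = q + 1 \/ x = q + 1 /\ y + 1 = q
   \/ x = q + 1 /\ y = q + 1 \/ x = q /\ y = q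
   \/ x = q + 1 /\ y = q \/ x = 1 /\ y = q
   \/ x = q /\ y = q + 1 \/ x = q /\ y = 1)%N.
Proof. lia. Qed.

Lemma difference_odd q m x y : (2 < q)%N -> q.+1 = m.*2 ->
  (0 < x <= m)%N -> (0 < y <= m)%N -> let d := (q * m)%N in
  (q * x = y \/ q * x = d \/ q * x + x + y = d \/ q * x + x = d \/ q * x + y = d)%N ->
  (x = m \/ x + 1 = m /\ y = m)%N.
Proof.
move=> q2 qm /andP[x0 xq] /andP[y0 yq] d [|[|[|[|]]]]; rewrite /d => E.
- nia.
- left; nia.
- have dv : (q %| x + y)%N by apply/dvdnP; exists (m - x)%N; nia.
  have rg : (0 < x + y <= 2 * q + 2)%N by lia.
  by case: (multiple_in_range q2 rg dv) => ?; nia.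
- have /eqP : (m * (2 * x) = m * q)%N by nia.
  by rewrite eqn_pmul2l; lia.
have dv : (q %| y)%N by apply/dvdnP; exists (m - x)%N; nia.
have rg : (0 < y <= 2 * q + 2)%N by lia.
  by case: (multiple_in_range q2 rg dv) => ?; nia.
Qed.

Section Classification.
Variables (k : closedFieldType) (q d i j : nat) (B : 'M[k]_4).
Hypotheses (uB : B \in unitmx) (sumB : cell_sums q d i j B).
Hypotheses (q_ge3 : (3 <= q)%N) (i_gt0 : (0 < i)%N) (ij : (i < j)%N) (jd : (j < d)%N).
Local Notation e := (expo d i j).

Let q_gt1 : (1 < q)%N := ltnW q_ge3.

Lemma small_first : (q * i <= d)%N.
Proof.
have [a [a' [b [bE _ E]]]] := first_column uB sumB q_gt1 i_gt0 ij jd.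
have ib : (i <= e b)%N by case: bE => ->; rewrite expoE // ltnW.
by have := expo_le a ij jd; nia.
Qed.

Lemma small_last : (q * (d - j) <= d)%N.
Proof.
have [a [a' [b [bE _ E]]]] := last_column uB sumB q_gt1 i_gt0 ij jd.
have bj : (e b <= j)%N by case: bE => ->; rewrite expoE // ltnW.
by have := expo_le a ij jd; nia.
Qed.

Lemma exponents_segre : d = (q + 1)%N -> i = 1%N /\ j = q.
Proof.
move=> dE; have i1 : i = 1%N by have := small_first; nia.
have : (d - j = 1)%N by have := small_last; nia.
lia.
Qed.

Hypothesis gcd1 : gcdn (gcdn d i) j = 1%N.

Lemma common_divisor m : (m %| d -> m %| i -> m %| j -> m = 1)%N.
Proof. by move=> md mi mj; apply/eqP; rewrite -dvdn1 -gcd1 !dvdn_gcd md mi. Qed.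

Lemma first_difference : (d < q * j)%N -> let i' := (d - j)%N in
  (q * i = i' \/ q * i = d \/ q * i + i + i' = d \/ q * i + i = d \/ q * i + i' = d)%N.
Proof.
move=> dj i'; have [a [a' [b [bE n]]]] := first_column uB sumB q_gt1 i_gt0 ij jd.
have := expo_le a ij jd.
case: bE => ->; rewrite expoE; last lia.
rewrite /i'; have qi : (i < q * i)%N by nia.
by move: n; elim/ord4_ind: a; elim/ord4_ind: a'; rewrite !expoE => n ae E;
  try (by case: n); lia.
Qed.

Lemma last_difference : (d < q * (d - i))%N -> let i' := (d - j)%N in
  (q * i' = i \/ q * i' = d \/ q * i' + i' + i = d \/ q * i' + i' = d \/ q * i' + i = d)%N.
Proof.
move=> dj i'; have [a [a' [b [bE n]]]] := last_column uB sumB q_gt1 i_gt0 ij jd.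
have := expo_le a ij jd.
case: bE => ->; rewrite expoE; first by rewrite /i'; lia.
rewrite /i'; have qi : (d - j < q * (d - j))%N by nia.
by move: n; elim/ord4_ind: a; elim/ord4_ind: a'; rewrite !expoE => n ae E;
  try (by case: n); lia.
Qed.

(** Modulo q a collision only sees the row exponents, so q cannot divide all of them but one. *)
Lemma row_dvd a : (forall a', a' <> a -> q %| e a')%N -> (q %| e a)%N.
Proof.
move=> dv; have [a' /dv] := row_congruence uB sumB q_gt1 i_gt0 ij jd a.
by rewrite /dvdn => /eqP -> <-.
Qed.

Lemma exponents_even : d = (q * (q + 1))%N ->
  (i + 1 = q /\ j + 1 = q * q \/ i = q + 1 /\ j = q * q + 1)%N.
Proof.
move=> dE.
have iq : (0 < i <= q + 1)%N by have := small_first; nia.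
have i'q : (0 < d - j <= q + 1)%N by have := small_last; nia.
have h1 : (d < q * j)%N by nia.
have h2 : (d < q * (d - i))%N by nia.
have x_cases := difference_even q_ge3 iq i'q; rewrite -dE in x_cases.
have y_cases := difference_even q_ge3 i'q iq; rewrite -dE in y_cases.
have cases := difference_even_sym q_ge3 (x_cases (first_difference h1))
  (y_cases (last_difference h2)).
clear x_cases y_cases.
have row1 : (q %| j -> q %| d -> q %| i)%N.
  move=> qj qd; apply: (@row_dvd o1); by elim/ord4_ind => n; rewrite ?expoE //; case: n.
have row2 : (q %| i -> q %| d -> q %| j)%N.
  move=> qi qd; apply: (@row_dvd o2); by elim/ord4_ind => n; rewrite ?expoE //; case: n.
have qd : (q %| d)%N by rewrite dE dvdn_mulr.
have pred_ndvd x y : (x + 1 = q * y)%N -> ~ (q %| x)%N.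
  move=> xE qx; have : (q %| x + 1)%N by rewrite xE dvdn_mulr.
  by rewrite dvdn_addr // dvdn1; lia.
have ndvd1 : ~ (q %| 1)%N by rewrite dvdn1; lia.
have dj : d = (j + (d - j))%N by rewrite subnKC // ltnW.
move: cases dj; move: (d - j)%N => y cases dj; move: cases.
have {}dj : (q * q + q = j + y)%N by rewrite -dj dE mulnDr muln1.
clear h1 h2 iq i'q.
(* The third and fourth pairs give the common divisors q + 1 and q. In each of the last four, q
   divides d and exactly one of i, j, against [row_dvd]. *)
move=> [|[|[|[|[|[|[]]]]]]] [iE jE].
- by left; lia.
- by right; lia.
- have := @common_divisor (q + 1)%N; rewrite {1}dE iE dvdn_mull // dvdnn.
  have -> : j = ((q - 1) * (q + 1))%N by rewrite mulnBl mulnDr; lia.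
  by rewrite dvdn_mull //; lia.
- have := @common_divisor q; rewrite qd iE dvdnn.
  have -> : j = (q * q)%N by lia.
  by rewrite dvdn_mulr //; lia.
- have : (q %| j)%N by apply/dvdnP; exists q; lia.
  by move/row1/(_ qd); rewrite iE dvdn_addr.
- have : (q %| j)%N by apply/dvdnP; exists q; lia.
  by move/row1/(_ qd); rewrite iE.
- have [] : ~ (q %| j)%N by apply: (pred_ndvd _ q); lia.
  by apply: row2; rewrite ?iE.
have [] : ~ (q %| j)%N by apply: (pred_ndvd _ (q + 1)%N); rewrite mulnDr; lia.
by apply: row2; rewrite ?iE.
Qed.

(** Besides the two expected solutions only i = d - j = m satisfies both difference conditions, and
    then m, which is at least 2, divides d, i and j. *)
Lemma exponents_odd m : q.+1 = m.*2 -> d = (q * m)%N ->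
  (i + 1 = m /\ j + m = q * m \/ i = m /\ j + m = q * m + 1)%N.
Proof.
move=> qm dE.
have iq : (0 < i <= m)%N by have := small_first; nia.
have i'q : (0 < d - j <= m)%N by have := small_last; nia.
have h1 : (d < q * j)%N by nia.
have h2 : (d < q * (d - i))%N by nia.
have := difference_odd q_ge3 qm iq i'q; rewrite -dE => /(_ (first_difference h1)).
have := difference_odd q_ge3 qm i'q iq; rewrite -dE => /(_ (last_difference h2)).
move=> [i'E|[i'E iE]] [iE'|[iE' i'E']]; try lia.
have := @common_divisor m; rewrite dE iE' dvdn_mull // dvdnn.
have -> : j = ((q - 1) * m)%N by nia.
by rewrite dvdn_mull //; lia.
Qed.

End Classification.

(** * Supports and normal forms *)

(** The tensor product of the 2 x 2 matrix with rows (a, b) and (c, d), pairing (s, t) with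
    (s^(q^2), t^(q^2)), and of the alternating form on (s^q, t^q). *)
Definition segre_form (k : closedFieldType) (a b c d : k) : 'M[k]_4 :=
  mx4 [:: [:: 0; a; 0; b]; [:: 0; c; 0; d]; [:: - a; 0; - b; 0]; [:: - c; 0; - d; 0]].

Definition torus_form (k : closedFieldType) (a b : k) : 'M[k]_4 :=
  mx4 [:: [:: 0; 0; 0; a]; [:: 0; b; 0; 0]; [:: - b; 0; 0; 0]; [:: 0; 0; - a; 0]].

Lemma segre_form_support (k : closedFieldType) q (B : 'M[k]_4) : (3 <= q)%N ->
  cell_sums q (q + 1) 1 q B -> B = segre_form (B o0 o1) (B o0 o3) (B o1 o1) (B o1 o3).
Proof.
(* The product q * q is an atom for [lia]. The bound 3 q <= q q is what separates the cells, and
   fails at q = 2. *)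
move=> q3 sumB; have [qq1 qq2] : (q * (q + 1) = q * q + q /\ 3 * q <= q * q)%N by nia.
have iso := isolated_cell sumB; have pair := paired_cells sumB.
apply/matrixP; elim/ord4_ind; elim/ord4_ind; rewrite !mxE //=;
  try (apply: iso; elim/ord4_ind; elim/ord4_ind; rewrite !expoE ?qq1 //; clear -q3 qq2; lia).
all: apply: pair; rewrite ?expoE //; first (by clear -q3 qq1; lia).
all: elim/ord4_ind; elim/ord4_ind; rewrite !expoE ?qq1; try (by left); try (by right).
all: clear -q3 qq2; lia.
Qed.

(* The exponents of both families of degree q (q + 1) / N: up to the factor N,
   (0, q - 1, q^2 - 1, q^2 + q). *)
Definition torus_exponents N q d i j : Prop :=
  [/\ (N == 1%N) || (N == 2), N * i + 1 = q, N * j + 1 = q * q & N * d = q * q + q]%N.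

Section TorusExponents.
Variables (N q d i j : nat).
Hypotheses (q_gt1 : (1 < q)%N) (nE : torus_exponents N q d i j).

(** The products of q with the exponents, rewritten in the atoms q * q and q * (q * q), so that
    collisions of cells become linear questions. *)
Lemma torus_exponents_lin :
  [/\ N * (q * i) + q = q * q, N * (q * j) + q = q * (q * q)
    & N * (q * d) = q * (q * q) + q * q]%N.
Proof. by case: nE => _ iE jE dE; rewrite ![(N * (q * _))%N]mulnCA; split; nia. Qed.

Lemma torus_exponents_bounds : [/\ 0 < i, i < j & j < d]%N.
Proof. by case: nE => /orP[]/eqP NE iE jE dE; subst N; split; nia. Qed.

Lemma torus_cells :
  (expo d i j o0 + q * expo d i j o3 = expo d i j o3 + q * expo d i j o2)%N
  /\ (expo d i j o1 + q * expo d i j o1 = expo d i j o2 + q * expo d i j o0)%N.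
Proof.
have [l1 l2 l3] := torus_exponents_lin.
rewrite !expoE; case: nE => /orP[]/eqP NE iE jE dE; subst N; lia.
Qed.

Lemma torus_form_support (k : closedFieldType) (B : 'M[k]_4) : (3 <= q)%N ->
  cell_sums q d i j B -> B = torus_form (B o0 o3) (B o1 o1).
Proof.
move=> q3 sumB.
have [l1 l2 l3] := torus_exponents_lin; have [c1 c2] := torus_cells.
have [x3 y3] : (3 * q <= q * q /\ 3 * (q * q) <= q * (q * q))%N by nia.
have iso := isolated_cell sumB; have pair := paired_cells sumB.
case: nE => NE iE jE dE.
apply/matrixP; elim/ord4_ind; elim/ord4_ind; rewrite !mxE //=;
  try (apply: iso; elim/ord4_ind; elim/ord4_ind; rewrite !expoE //;
       clear -q3 NE l1 l2 l3 x3 y3 iE jE dE; case/orP: NE => /eqP NE; subst N; lia).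
all: apply: pair => //.
all: elim/ord4_ind; elim/ord4_ind; rewrite !expoE; try (by left); try (by right).
all: clear -q3 NE l1 l2 l3 x3 y3 iE jE dE; case/orP: NE => /eqP NE; subst N; lia.
Qed.

Lemma torus_form_cells (k : closedFieldType) (a b : k) :
  cell_sums q d i j (torus_form a b).
Proof.
move=> v; have [c1 c2] := torus_cells.
rewrite !sum_ord4 !mxE /= !if_same c1 c2.
by case: eqP; case: eqP => _ _; ring.
Qed.

End TorusExponents.

Lemma segre_form_cells (k : closedFieldType) q (a b c d : k) :
  cell_sums q (q + 1) 1 q (segre_form a b c d).
Proof.
move=> v; rewrite !sum_ord4 !mxE /= !if_same !expoE !muln0 !muln1 !addn0 !add0n.
rewrite mulnDr muln1 ![(q * q + q)%N]addnC [(1 + q)%N]addnC [(1 + (q + _))%N]addnCA addnA.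
by do 4! case: eqP => _; ring.
Qed.

Lemma vline_scale (K : fieldType) (V : vectType K) (c : K) (v : V) :
  c != 0 -> (<[c *: v]> = <[v]>)%VS.
Proof.
move=> c0; apply: subv_anti; rewrite -!memvE memvZ ?memv_line //=.
by rewrite -[v in v \in _]scale1r -(mulVf c0) -scalerA memvZ ?memv_line.
Qed.

(** The substitution [phi] of (s, t) is realized on the monomials by the matrix [H], up to scalars
    that lines ignore; [psi] shows that it reaches every (s, t). *)
Lemma reparametrize (k : closedFieldType) (F H : 'M[k]_4) d i j d' i' j'
    (phi psi : k * k -> k * k) :
  (forall st, st != (0, 0) -> phi st != (0, 0) /\
     exists2 c, c != 0 & H *m monomial_vec d i j st = c *: monomial_vec d' i' j' (phi st)) ->
  (forall st, st != (0, 0) -> psi st != (0, 0) /\ phi (psi st) = st) ->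
  C_ (F *m H) d i j = C_ F d' i' j'.
Proof.
move=> phiP psiP; have FHE st : st != (0, 0) ->
    (<[F *m H *m monomial_vec d i j st]> = <[F *m monomial_vec d' i' j' (phi st)]>)%VS.
  by move/phiP => [_ [c c0 E]]; rewrite -mulmxA E -scalemxAr vline_scale.
apply/seteqP; split=> _ [st /= st0 <-].
  by exists (phi st); [case: (phiP st st0) | rewrite FHE].
have [psi0 phipsi] := psiP st st0.
by exists (psi st) => //; rewrite FHE // phipsi.
Qed.

Lemma C_swap (k : closedFieldType) (F : 'M[k]_4) d i j :
  C_ (F *m perm_mx (tperm o1 o2)) d j i = C_ F d i j.
Proof.
apply: (@reparametrize _ _ _ _ _ _ _ _ _ id id) => st st0; split=> //.
exists 1; rewrite ?oner_neq0 // scale1r -row_permE; case: st {st0} => s t.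
apply/colP; elim/ord4_ind; rewrite !mxE.
- by rewrite tpermD.
- by rewrite tpermL.
- by rewrite tpermR.
by rewrite tpermD.
Qed.

Lemma C_reverse (k : closedFieldType) (F : 'M[k]_4) d i j : (i <= d)%N -> (j <= d)%N ->
  C_ (F *m perm_mx (perm rev_ord_inj)) d (d - j) (d - i) = C_ F d i j.
Proof.
move=> id jd.
apply: (@reparametrize _ _ _ _ _ _ _ _ _ (fun st => (st.2, st.1)) (fun st => (st.2, st.1))).
  case=> s t st0; split; first by apply: contraNneq st0 => -[-> ->].
  exists 1; rewrite ?oner_neq0 // scale1r -row_permE.
  by apply/colP; elim/ord4_ind; rewrite !mxE permE /= ?subKn // mulrC.
by case=> s t st0; split=> //; apply: contraNneq st0 => -[-> ->].
Qed.

(* The Kronecker product of a 2 x 2 matrix x, acting on (s, t), and a 2 x 2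
   matrix y, acting on (s^q, t^q). *)
Definition kron2 (k : closedFieldType) (x y : 'M[k]_2) : 'M[k]_4 :=
  mx4 [:: [:: x 0 0 * y 0 0; x 0 1 * y 0 0; x 0 0 * y 0 1; x 0 1 * y 0 1];
          [:: x 1 0 * y 0 0; x 1 1 * y 0 0; x 1 0 * y 0 1; x 1 1 * y 0 1];
          [:: x 0 0 * y 1 0; x 0 1 * y 1 0; x 0 0 * y 1 1; x 0 1 * y 1 1];
          [:: x 1 0 * y 1 0; x 1 1 * y 1 0; x 1 0 * y 1 1; x 1 1 * y 1 1]].

(** The alternating factor is transformed by [y] on both sides and is multiplied by the determinant
    of [y]; the other factor N becomes x^T N z. *)
Lemma segre_form_congruence (k : closedFieldType) (x y z : 'M[k]_2) (a b c d : k) :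
  let n r r' := x 0 r * (a * z 0 r' + b * z 1 r') + x 1 r * (c * z 0 r' + d * z 1 r') in
  (kron2 x y)^T *m segre_form a b c d *m kron2 y z
  = (y 0 0 * y 1 1 - y 0 1 * y 1 0) *: segre_form (n 0 0) (n 0 1) (n 1 0) (n 1 1).
Proof.
move=> n; rewrite /n {n}; set B := _ *m segre_form _ _ _ _.
have BE : B = mx4
  [:: [:: - (x 0 0 * a + x 1 0 * c) * y 1 0; (x 0 0 * a + x 1 0 * c) * y 0 0;
          - (x 0 0 * b + x 1 0 * d) * y 1 0; (x 0 0 * b + x 1 0 * d) * y 0 0];
      [:: - (x 0 1 * a + x 1 1 * c) * y 1 0; (x 0 1 * a + x 1 1 * c) * y 0 0;
          - (x 0 1 * b + x 1 1 * d) * y 1 0; (x 0 1 * b + x 1 1 * d) * y 0 0];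
      [:: - (x 0 0 * a + x 1 0 * c) * y 1 1; (x 0 0 * a + x 1 0 * c) * y 0 1;
          - (x 0 0 * b + x 1 0 * d) * y 1 1; (x 0 0 * b + x 1 0 * d) * y 0 1];
      [:: - (x 0 1 * a + x 1 1 * c) * y 1 1; (x 0 1 * a + x 1 1 * c) * y 0 1;
          - (x 0 1 * b + x 1 1 * d) * y 1 1; (x 0 1 * b + x 1 1 * d) * y 0 1]].
  by apply/matrixP; elim/ord4_ind; elim/ord4_ind; rewrite !mxE !sum_ord4 !mxE /=; ring.
rewrite {}BE.
by apply/matrixP; elim/ord4_ind; elim/ord4_ind; rewrite !mxE !sum_ord4 !mxE /=; ring.
Qed.

Lemma det_mx2 (R : comNzRingType) (g : 'M[R]_2) : \det g = g 0 0 * g 1 1 - g 0 1 * g 1 0.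
Proof.
rewrite (expand_det_row _ ord0) !big_ord_recl big_ord0 /cofactor !det_mx11 !mxE /=.
rewrite (_ : lift ord0 ord0 = 1); last exact: val_inj.
rewrite (_ : lift 1 0 = 0); last exact: val_inj.
by rewrite expr0 expr1; ring.
Qed.

Lemma T_increasing (k : closedFieldType) q (A : 'M[k]_4) d C : T_ q A d C -> exists F i j,
  [/\ F \in unitmx, (0 < i)%N /\ (i < j)%N /\ (j < d)%N, gcdn (gcdn d i) j = 1%N
    & C = C_ F d i j].
Proof.
case=> _ _ [F [i [j [uF [/andP[i0 id] /andP[j0 jd] ij gcd1] ->]]]].
have [lt_ij|lt_ji|//] := ltngtP i j.
  by exists F, i, j; split=> //; lia.
exists (F *m perm_mx (tperm o1 o2)), j, i; split; last by rewrite C_swap.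
- by rewrite unitmx_mul uF unitmx_perm.
- by lia.
by rewrite gcdnAC.
Qed.

Section NormalForms.
Variables (k : closedFieldType) (q : nat) (pq : [pchar k].-nat q) (A : 'M[k]_4).
Hypothesis A_unit : A \in unitmx.

Definition pullback (F : 'M[k]_4) : 'M[k]_4 := F^T *m A *m qpow q F.

Lemma pullbackM F H : pullback (F *m H) = H^T *m pullback F *m qpow q H.
Proof. by rewrite /pullback (qpowM pq) trmx_mul !mulmxA. Qed.

Lemma pullback_unit F : F \in unitmx -> pullback F \in unitmx.
Proof. by move=> uF; rewrite !unitmx_mul unitmx_tr (qpow_unit pq) uF A_unit. Qed.

Lemma sub_cells F d i j : F \in unitmx -> (i <= d)%N -> (j <= d)%N ->
  C_ F d i j `<=` X_ q A -> cell_sums q d i j (pullback F).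
Proof. by move=> uF id jd /(C_subX pq _ _ _ _ uF)/(cell_sumsP pq _ id jd). Qed.

Lemma segre_form_unit : segre_form (1 : k) 0 0 1 \in unitmx.
Proof.
have [] // : segre_form (1 : k) 0 0 1 \in unitmx /\ (segre_form (1 : k) 0 0 1)^T \in unitmx.
apply: mulmx1_unit; apply/matrixP; elim/ord4_ind; elim/ord4_ind.
all: by rewrite !mxE !sum_ord4 !mxE /=; ring.
Qed.

Lemma torus_form_unit : torus_form (1 : k) 1 \in unitmx.
Proof.
have [] // : torus_form (1 : k) 1 \in unitmx /\ (torus_form (1 : k) 1)^T \in unitmx.
apply: mulmx1_unit; apply/matrixP; elim/ord4_ind; elim/ord4_ind.
all: by rewrite !mxE !sum_ord4 !mxE /=; ring.
Qed.

Hypothesis q_ge3 : (3 <= q)%N.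

Lemma normalize_torus N d i j F : torus_exponents N q d i j -> F \in unitmx ->
  C_ F d i j `<=` X_ q A ->
  exists F', [/\ F' \in unitmx, C_ F' d i j = C_ F d i j & pullback F' = torus_form 1 1].
Proof.
move=> nE uF sub; have q1 : (1 < q)%N := ltnW q_ge3.
have [i0 ij jd] := torus_exponents_bounds q1 nE.
have id := ltnW (ltn_trans ij jd); have jd' := ltnW jd.
have sumB := sub_cells uF id jd' sub.
have uB := pullback_unit uF.
have BE := torus_form_support q1 nE q_ge3 sumB.
set a := pullback F o0 o3 in BE; set b := pullback F o1 o1 in BE.
have a0 : a != 0.
  apply: contraTneq uB => a0; rewrite BE a0; apply/negP => uB.
  have /(congr1 (mulmx^~ (invmx (torus_form 0 b)))) : delta_mx 0 o0 *m torus_form 0 b = 0 :> 'rV_4.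
    by rewrite -rowE; apply/rowP; elim/ord4_ind; rewrite !mxE.
  rewrite mulmxK // mul0mx => /rowP/(_ o0)/eqP.
  by rewrite !mxE !eqxx oner_eq0.
have b0 : b != 0.
  apply: contraTneq uB => b0; rewrite BE b0; apply/negP => uB.
  have /(congr1 (mulmx^~ (invmx (torus_form a 0)))) : delta_mx 0 o1 *m torus_form a 0 = 0 :> 'rV_4.
    by rewrite -rowE; apply/rowP; elim/ord4_ind; rewrite !mxE.
  rewrite mulmxK // mul0mx => /rowP/(_ o1)/eqP.
  by rewrite !mxE !eqxx oner_eq0.
(* The substitution t |-> u t with a factor c multiplies the cell (r, r') by c^(q+1) u^(e_r + q
   e_r'). Making both coefficients 1 requires u^(dq - i(q+1)) = b / a and then determines c^(q+1);
   colliding cells get the same factor. *)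
have lt_iqd : (i * q.+1 < d * q)%N.
  by case: nE => /orP[]/eqP NE iE jE dE; subst N; nia.
have [u uE] := @closed_expr k _ (b / a) (etrans (subn_gt0 _ _) lt_iqd).
have u0 : u != 0.
  apply/eqP => u0; move/eqP: uE; rewrite u0 expr0n gtn_eqF ?subn_gt0 //= eq_sym.
  by rewrite mulf_eq0 invr_eq0 (negPf a0) (negPf b0).
have [c cE] := @closed_expr k q.+1 (b * u ^+ (i * q.+1))^-1 isT.
have bu0 : b * u ^+ (i * q.+1) != 0 by rewrite mulf_neq0 // expf_neq0.
have c0 : c != 0.
  by apply/eqP => c0; move/eqP: cE; rewrite c0 expr0n eq_sym invr_eq0 (negPf bu0).
have cb : c ^+ q.+1 * (b * u ^+ (i * q.+1)) = 1 by rewrite cE mulVf.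
have ca : c ^+ q.+1 * (a * u ^+ (d * q)) = 1.
  by rewrite -cb -(subnKC (ltnW lt_iqd)) exprD uE; field.
pose D : 'rV[k]_4 := \row_r (c * u ^+ expo d i j r).
have [c1 c2] := torus_cells q1 nE.
exists (F *m diag_mx D); split.
- rewrite unitmx_mul uF unitmxE det_diag unitfE prodf_seq_neq0.
  by apply/allP => r _; rewrite mxE mulf_neq0 // expf_neq0.
- apply: (@reparametrize _ _ _ _ _ _ _ _ _ (fun st => (st.1, u * st.2))
          (fun st => (st.1, u^-1 * st.2))) => st st0; split.
  + by apply: contraNneq st0; case: st => s t /= [-> /eqP]; rewrite mulf_eq0 (negPf u0) => /eqP->.
  + exists c => //; rewrite !monomial_vecE // mul_diag_mx.
    by apply/colP => r; rewrite !mxE /= exprMn; ring.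
  + apply: contraNneq st0; case: st => s t /= [-> /eqP].
    by rewrite mulf_eq0 invr_eq0 (negPf u0) => /eqP->.
  by case: st {st0} => s t /=; rewrite mulVKf.
rewrite pullbackM BE tr_diag_mx (qpowE pq) map_diag_mx mul_mx_diag mul_diag_mx.
have entry r r' : (c * u ^+ expo d i j r) * (c * u ^+ expo d i j r') ^+ q
    = c ^+ q.+1 * u ^+ (expo d i j r + q * expo d i j r').
  by rewrite exprMn exprS exprD -exprM [(_ * q)%N]mulnC; ring.
have e03 : (c * u ^+ expo d i j o0) * (c * u ^+ expo d i j o3) ^+ q * a = 1.
  by rewrite entry -ca add0n !expoE mulnC; ring.
have e11 : (c * u ^+ expo d i j o1) * (c * u ^+ expo d i j o1) ^+ q * b = 1.
  by rewrite entry -cb !expoE mulnS mulnC; ring.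
have e20 : (c * u ^+ expo d i j o2) * (c * u ^+ expo d i j o0) ^+ q * b = 1.
  by rewrite entry -c2 -entry.
have e32 : (c * u ^+ expo d i j o3) * (c * u ^+ expo d i j o2) ^+ q * a = 1.
  by rewrite entry -c1 -entry.
apply/matrixP; elim/ord4_ind; elim/ord4_ind; rewrite !mxE /= ?mulr0 ?mul0r //;
  rewrite /frob_of.
- by rewrite -[RHS]e03; ring.
- by rewrite -[RHS]e11; ring.
- by rewrite -[in RHS]e20; ring.
by rewrite -[in RHS]e32; ring.
Qed.

Lemma normalize_segre F : F \in unitmx -> C_ F (q + 1) 1 q `<=` X_ q A ->
  exists F', [/\ F' \in unitmx, C_ F' (q + 1) 1 q = C_ F (q + 1) 1 q
    & pullback F' = segre_form 1 0 0 1].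
Proof.
move=> uF sub; have q1 : (1 < q)%N := ltnW q_ge3.
have [e1 e2] : (1 <= q + 1)%N /\ (q <= q + 1)%N by lia.
have sumB := sub_cells uF e1 e2 sub.
have uB := pullback_unit uF.
have BE := segre_form_support q_ge3 sumB.
move: (pullback F o0 o1) (pullback F o0 o3) (pullback F o1 o1) (pullback F o1 o3) BE
  => a b c d BE; rewrite BE in uB.
pose N : 'M[k]_2 := 
  \matrix_(r, r') if r == 0 then if r' == 0 then a else b else if r' == 0 then c else d.
have uN : N \in unitmx.
  rewrite unitmxE unitfE; apply/negP => /det0P[w wN0 /rowP wN].
  have := wN 0; have := wN 1; rewrite !mxE !big_ord_recl !big_ord0 !mxE /= !addr0 => w2 w1.
  pose w' : 'rV[k]_4 := \row_r [:: w 0 0; w 0 (lift ord0 ord0); 0; 0]`_r.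
  have /(congr1 (mulmx^~ (invmx (segre_form a b c d)))) : w' *m segre_form a b c d = 0.
    apply/rowP; elim/ord4_ind; rewrite !mxE !sum_ord4 !mxE /=; last 1 first.
    - by rewrite -[RHS]w2; ring.
    - ring.
    - by rewrite -[RHS]w1; ring.
    ring.
  rewrite mulmxK // mul0mx => /rowP w'0; have := w'0 o0; have := w'0 o1.
  rewrite !mxE /= => w10 w00; case/eqP: wN0; apply/rowP => r; rewrite mxE.
  by case: (unliftP ord0 r) => [r' ->|->]; rewrite ?ord1.
have pqq : [pchar k].-nat (q * q)%N by rewrite pnatM pq.
have qq1 : (1 < q * q)%N by nia.
have [g ug gE] := hermitian_diagonalization pqq qq1 uN.
(* When g acts on (s, t), its Frobenius twist acts on (s^q, t^q), and N becomes g^T N g^(q^2), which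
   is 1 by the choice of g. The leftover determinant is absorbed below by the scalar l. *)
pose H := kron2 g (qpow q g).
have HQ : qpow q H = kron2 (qpow q g) (qpow (q * q) g).
  apply/matrixP; elim/ord4_ind; elim/ord4_ind; by rewrite !mxE /= exprMn -exprM.
have dg : \det g != 0 by rewrite -unitfE -unitmxE.
have D0 : \det g ^+ q != 0 by rewrite expf_neq0.
have HE : H^T *m segre_form a b c d *m qpow q H = (\det g ^+ q) *: segre_form 1 0 0 1.
  have gN r r' : g 0 r * (a * qpow (q * q) g 0 r' + b * qpow (q * q) g 1 r')
      + g 1 r * (c * qpow (q * q) g 0 r' + d * qpow (q * q) g 1 r') = (r == r')%:R.
    have /matrixP/(_ r r') := gE; rewrite !mxE => <-.
    rewrite !big_ord_recl !big_ord0 !mxE !big_ord_recl !big_ord0 !mxE /=.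
    rewrite (_ : lift ord0 ord0 = 1); last exact: val_inj.
    by ring.
  rewrite HQ segre_form_congruence !gN /=; congr (_ *: _).
  rewrite -det_mx2 (qpowE pq) det_map_mx //.
have uH : H \in unitmx.
  have : (\det g ^+ q) *: segre_form 1 0 0 1 \in unitmx.
    by rewrite unitmxZ ?unitfE // segre_form_unit.
  by rewrite -HE !unitmx_mul unitmx_tr => /andP[/andP[]].
have [l lE] := @closed_expr k q.+1 (\det g ^+ q)^-1 isT.
have l0 : l != 0.
  by apply/eqP => l0; move/eqP: lE; rewrite l0 expr0n eq_sym invr_eq0 (negPf D0).
exists (F *m (l *: H)); split.
- by rewrite unitmx_mul uF unitmxZ ?unitfE.
- apply: (@reparametrize _ _ _ _ _ _ _ _ _
    (fun st => (g 0 0 * st.1 + g 0 1 * st.2, g 1 0 * st.1 + g 1 1 * st.2))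
    (fun st => ((g 1 1 * st.1 - g 0 1 * st.2) / \det g, (g 0 0 * st.2 - g 1 0 * st.1) / \det g))).
  + move=> [s t] st0; split.
      apply: contraNneq st0 => -[/= E1 E2].
      have sE : s * \det g = g 1 1 * (g 0 0 * s + g 0 1 * t) - g 0 1 * (g 1 0 * s + g 1 1 * t).
        by rewrite det_mx2; ring.
      have tE : t * \det g = g 0 0 * (g 1 0 * s + g 1 1 * t) - g 1 0 * (g 0 0 * s + g 0 1 * t).
        by rewrite det_mx2; ring.
      move/eqP: sE; move/eqP: tE; rewrite E1 E2 !mulr0 subr0 !mulf_eq0 (negPf dg) !orbF.
      by move=> /eqP-> /eqP->.
    exists l => //; rewrite -scalemxAl; congr (_ *: _).
    by apply/colP; elim/ord4_ind; rewrite !mxE sum_ord4 !mxE /= ?addnK ?addKn ?addn1 !exprS;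
      rewrite ?expr0 ?(exprDn_pchar _ _ pq) ?exprMn; ring.
  move=> [s t] st0 /=; split; last by rewrite det_mx2 in dg *; congr (_, _); field.
  apply: contraNneq st0 => -[/eqP E1 /eqP E2].
  move: E1 E2; rewrite !mulf_eq0 invr_eq0 (negPf dg) !orbF => /eqP E1 /eqP E2.
  have sE : s * \det g = g 0 0 * (g 1 1 * s - g 0 1 * t) + g 0 1 * (g 0 0 * t - g 1 0 * s).
    by rewrite det_mx2; ring.
  have tE : t * \det g = g 1 0 * (g 1 1 * s - g 0 1 * t) + g 1 1 * (g 0 0 * t - g 1 0 * s).
    by rewrite det_mx2; ring.
  move/eqP: sE; move/eqP: tE; rewrite E1 E2 !mulr0 addr0 !mulf_eq0 (negPf dg) !orbF.
  by move=> /eqP-> /eqP->.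
rewrite pullbackM BE linearZ (qpowZ pq) /= -!scalemxAl -scalemxAr HE !scalerA.
rewrite -[RHS]scale1r; congr (_ *: _); by rewrite -exprS lE mulVf.
Qed.

End NormalForms.

(** * Orbits *)

Section Orbits.
Variables (k : closedFieldType) (q : nat) (pq : [pchar k].-nat q) (A : 'M[k]_4).
Hypothesis A_unit : A \in unitmx.

Lemma act_C (P F : 'M[k]_4) d i j : act (scalar_coset P) (C_ F d i j) = C_ (P *m F) d i j.
Proof.
apply/seteqP; split=> [_ [_ [c /= c0 <-]] [_ [st st0 <-]] <-|_ [st st0 <-]].
  exists st => //; rewrite limg_line lfunE /= -scalemxAl vline_scale // mulmxA //.
exists P; first by exists 1; rewrite /= ?oner_neq0 // scale1r.
exists <[F *m monomial_vec d i j st]>%VS; first by exists st.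
by rewrite limg_line lfunE /= mulmxA.
Qed.

Lemma orbit_sub F F' d i j : F \in unitmx -> F' \in unitmx ->
  pullback q A F = pullback q A F' ->
  orbit_ q A (C_ F d i j) `<=` orbit_ q A (C_ F' d i j).
Proof.
move=> uF uF' FF' _ [_ [P [uP [l l0 PE]] <-] <-].
exists (scalar_coset (P *m F *m invmx F')); last by rewrite !act_C mulmxKV.
exists (P *m F *m invmx F') => //=; split; first by rewrite !unitmx_mul uP uF unitmx_inv.
exists l => //; rewrite -/(pullback q A _) !(pullbackM pq) [pullback q A P]PE.
rewrite -scalemxAr -!scalemxAl -/(pullback q A F) FF' -scalemxAr -scalemxAl.
by rewrite -(pullbackM pq) mulmxV // /pullback (qpow1 pq) trmx1 mul1mx mulmx1.
Qed.

Lemma orbit_eq F F' d i j : F \in unitmx -> F' \in unitmx ->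
  pullback q A F = pullback q A F' ->
  orbit_ q A (C_ F d i j) = orbit_ q A (C_ F' d i j).
Proof. by move=> uF uF' FF'; apply/seteqP; split; apply: orbit_sub. Qed.

Lemma orbits_single d i j B :
  (forall C, T_ q A d C ->
     exists F, [/\ F \in unitmx, C = C_ F d i j & pullback q A F = B]) ->
  T_ q A d !=set0 -> exists o, orbits q A d = [set o].
Proof.
move=> normal [C0 TC0]; have [F0 [uF0 C0E F0E]] := normal _ TC0.
exists (orbit_ q A C0); apply/seteqP; split=> [_ [C TC <-]|_ ->]; last by exists C0.
have [F [uF -> FE]] := normal _ TC.
by rewrite C0E; apply: orbit_eq => //; rewrite FE.
Qed.

(** Here [n] and [n'] are the exponents of two monomials of the same degree in the coordinates of
    F^-1 x. On the curve their exponents of t differ by one, so their ratio is s : t, and they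
    define the rational inverse. *)
Lemma rational_curve_C (F : 'M[k]_4) d i j (n n' : 'I_4 -> nat) : F \in unitmx ->
  (i <= d)%N -> (j <= d)%N ->
  (\sum_r n r = \sum_r n' r)%N ->
  (\sum_r n' r * expo d i j r = (\sum_r n r * expo d i j r).+1)%N ->
  rational_curve d (C_ F d i j).
Proof.
move=> uF id jd sum_n sum_ne.
have le_d r : (expo d i j r <= d)%N by elim/ord4_ind: r.
pose M : 'M[k]_(4, d.+1) := F *m \matrix_(r, l) (l == inord (expo d i j r))%:R.
have ME st : binary_forms M st = F *m monomial_vec d i j st.
  rewrite /binary_forms -mulmxA monomial_vecE //; congr (_ *m _).
  apply/colP => r; rewrite !mxE (bigD1 (inord (expo d i j r))) //= !mxE eqxx mul1r.
  by rewrite inordK ?ltnS // big1 ?addr0 // => l /negPf l0; rewrite !mxE l0 mul0r.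
exists M; split.
- move=> st st0; rewrite ME; apply: contraNneq (monomial_vec_neq0 d i j st0) => F0.
  by rewrite -[monomial_vec _ _ _ _](mulKmx uF) F0 mulmx0.
- pose L r : {mpoly k[4]} := \sum_c invmx F r c *: 'X_c.
  have homL r : L r \is 1.-homog.
    by apply: rpred_sum => c _; apply: dhomogZ; rewrite dhomogX /= mdeg1.
  have LE r st : (L r).@[fun r => binary_forms M st r 0]
      = st.1 ^+ (d - expo d i j r) * st.2 ^+ expo d i j r.
    rewrite raddf_sum /=; under eq_bigr => c _ do rewrite mevalZ mevalXU.
    transitivity ((invmx F *m binary_forms M st) r 0); first by rewrite mxE.
    by rewrite ME mulKmx // monomial_vecE // mxE.
  pose G (m : 'I_4 -> nat) := L o0 ^+ m o0 * L o1 ^+ m o1 * L o2 ^+ m o2 * L o3 ^+ m o3.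
  pose N := (\sum_r n r)%N.
  have homG m : (\sum_r m r)%N = N -> G m \is N.-homog.
    move=> <-; rewrite sum_ord4 /G.
    have homX r e : L r ^+ e \is e.-homog by rewrite -[X in X.-homog]mul1n; apply: dhomogMn.
    by do 3! [apply: dhomogM => //].
  have GE m st : (\sum_r m r)%N = N -> (G m).@[fun r => binary_forms M st r 0]
      = st.1 ^+ (d * N - \sum_r m r * expo d i j r) * st.2 ^+ (\sum_r m r * expo d i j r).
    move=> mN; rewrite /G !rmorphM !rmorphXn /= !LE !exprMn -!exprM.
    have -> : (d * N - \sum_r m r * expo d i j r = \sum_r (d - expo d i j r) * m r)%N.
      rewrite -mN !sum_ord4.
      have le_dm r := leq_mul (le_d r) (leqnn (m r)).
      have := le_dm o0; have := le_dm o1; have := le_dm o2; have := le_dm o3.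
      rewrite !mulnDr !mulnBl; clear; lia.
    rewrite !sum_ord4 !exprD ![(m _ * _)%N]mulnC; ring.
  exists N, (G n), (G n'); split.
  + exact: homG.
  + exact: homG.
  + move=> st; rewrite !GE //.
    have : (\sum_r n' r * expo d i j r <= d * N)%N.
      rewrite /N sum_n big_distrr; apply: leq_sum => r _.
      by rewrite mulnC leq_mul2r le_d orbT.
    by rewrite sum_ne => lt_W; rewrite -(subnSK lt_W) !exprS; ring.
  exists (1, 1); rewrite !GE // !expr1n mulr1 xpair_eqE negb_and oner_eq0 //.
by apply/seteqP; split=> _ [st st0 <-]; exists st => //; rewrite ME.
Qed.

(** The weight relation is also a Bezout identity: it writes 1 as an integral combination of i, j
    and d. *)
Lemma admissible_bezout d i j (n n' : 'I_4 -> nat) :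
  (0 < i)%N -> (i < j)%N -> (j < d)%N ->
  (\sum_r n' r * expo d i j r = (\sum_r n r * expo d i j r).+1)%N -> admissible d i j.
Proof.
move=> i0 ij jd sum_ne; split; [by clear -i0 ij jd; lia..|].
set g := gcdn _ j; have g_dvd (m : 'I_4 -> nat) : (g %| \sum_r m r * expo d i j r)%N.
  apply: dvdn_sum => r _; apply: dvdn_mull; have gdi : (g %| gcdn d i)%N := dvdn_gcdl _ _.
  elim/ord4_ind: r; rewrite expoE.
  - exact: dvdn0.
  - exact: dvdn_trans gdi (dvdn_gcdr _ _).
  - exact: dvdn_gcdr.
  exact: dvdn_trans gdi (dvdn_gcdl _ _).
apply/eqP; rewrite -dvdn1; have := g_dvd n'.
by rewrite sum_ne -addn1 dvdn_addr.
Qed.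

Lemma T_nonempty (F : 'M[k]_4) d i j (n n' : 'I_4 -> nat) : F \in unitmx ->
  (0 < i)%N -> (i < j)%N -> (j < d)%N -> cell_sums q d i j (pullback q A F) ->
  (\sum_r n r = \sum_r n' r)%N ->
  (\sum_r n' r * expo d i j r = (\sum_r n r * expo d i j r).+1)%N ->
  T_ q A d (C_ F d i j).
Proof.
move=> uF i0 ij jd sumB sum_n sum_ne.
have jd' := ltnW jd; have id := leq_trans (ltnW ij) jd'.
split; first exact: (rational_curve_C uF id jd' sum_n sum_ne).
- by apply/(C_subX pq _ _ _ _ uF)/(cell_sumsP pq _ id jd').
by exists F, i, j; split=> //; apply: admissible_bezout sum_ne.
Qed.

Lemma orbits_segre : (3 <= q)%N -> exists o, orbits q A (q + 1) = [set o].
Proof.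
move=> q3; have q1 := ltnW q3.
apply: (@orbits_single _ 1 q (segre_form 1 0 0 1)) => [C TC|].
  have [F [i [j [uF [i0 [ij jd]] gcd1 CE]]]] := T_increasing TC.
  have sub : C_ F (q + 1) i j `<=` X_ q A by case: TC => _ + _; rewrite CE.
  have jd' := ltnW jd; have id := leq_trans (ltnW ij) jd'.
  have sumB := sub_cells pq uF id jd' sub.
  have [iE jE] := exponents_segre (pullback_unit pq A_unit uF) sumB q3 i0 ij jd erefl.
  subst i j.
  have [F' [uF' CE' F'E]] := normalize_segre pq A_unit q3 uF sub.
  by exists F'; split; rewrite // CE.
have [F uF FE] := qform_congruent pq q1 A_unit (segre_form_unit k).
exists (C_ F (q + 1) 1 q).
apply: (@T_nonempty _ _ _ _ (fun r => r == o0) (fun r => r == o1)) => //.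
- by rewrite addn1.
- by rewrite /pullback FE; apply: segre_form_cells.
- by rewrite !sum_ord4.
by rewrite !sum_ord4 !expoE.
Qed.

Lemma orbits_torus N d i j (n n' : 'I_4 -> nat) : (3 <= q)%N ->
  torus_exponents N q d i j ->
  (forall i' j' (B : 'M[k]_4), B \in unitmx -> cell_sums q d i' j' B -> (0 < i')%N -> (i' < j')%N ->
     (j' < d)%N -> gcdn (gcdn d i') j' = 1%N ->
     i' = i /\ j' = j \/ i' = (d - j)%N /\ j' = (d - i)%N) ->
  (\sum_r n r = \sum_r n' r)%N ->
  (\sum_r n' r * expo d i j r = (\sum_r n r * expo d i j r).+1)%N ->
  exists o, orbits q A d = [set o].
Proof.
move=> q3 nE classif sum_n sum_ne; have q1 := ltnW q3.
have [i0 ij jd] := torus_exponents_bounds q1 nE.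
have jd' := ltnW jd; have id := leq_trans (ltnW ij) jd'.
apply: (@orbits_single _ i j (torus_form 1 1)) => [C TC|].
  have [F [i' [j' [uF [i'0 [ij' j'd]] gcd1 CE]]]] := T_increasing TC.
  have sub : C `<=` X_ q A by case: TC.
  have [F1 uF1 CE1] : exists2 F1, F1 \in unitmx & C = C_ F1 d i j.
    have jd2 := ltnW j'd; have id2 := leq_trans (ltnW ij') jd2.
    have sumB : cell_sums q d i' j' (pullback q A F).
      by apply: sub_cells; rewrite // -CE.
    have [[iE jE]|[iE jE]] := classif _ _ _ (pullback_unit pq A_unit uF) sumB i'0 ij' j'd gcd1.
      by subst i' j'; exists F.
    exists (F *m perm_mx (perm rev_ord_inj)); first by rewrite unitmx_mul uF unitmx_perm.
    rewrite CE -(C_reverse _ id2 jd2) iE jE !subKn //.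
  have [|F' [uF' CE' F'E]] := normalize_torus pq A_unit q3 nE uF1; first by rewrite -CE1.
  by exists F'; split; rewrite // CE1.
have [F uF FE] := qform_congruent pq q1 A_unit (torus_form_unit k).
exists (C_ F d i j); apply: T_nonempty sum_n sum_ne => //.
by rewrite /pullback FE; apply: (torus_form_cells q1 nE).
Qed.

Lemma orbits_even : (3 <= q)%N -> (2 %| q)%N -> exists o, orbits q A (q * (q + 1)) = [set o].
Proof.
move=> q3 /dvdnP[h qE].
have qq : (q * (q + 1) = q * q + q)%N by rewrite mulnDr muln1.
have nE : torus_exponents 1 q (q * (q + 1)) (q - 1) (q * q - 1).
  by have : (3 <= q * q)%N by [nia]; rewrite /torus_exponents qq; split=> //; lia.
(* With q = 2h, h (q - 1) + (h - 1) (q^2 - 1) = (h - 1) (q^2 + q) + 1; both monomials have degree 2h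
   - 1. *)
apply: (@orbits_torus 1 _ (q - 1) (q * q - 1)
  (fun r => nth 0 [:: h; 0; 0; h - 1] r)%N (fun r => nth 0 [:: 0; h; h - 1; 0] r)%N) => //.
- move=> i' j' B uB sumB i'0 ij' j'd gcd1.
  have := exponents_even uB sumB q3 i'0 ij' j'd gcd1 erefl; rewrite qq.
  by have : (3 <= q * q)%N by [nia]; clear; lia.
- by rewrite !sum_ord4 /=; clear; lia.
rewrite !sum_ord4 !expoE /= qq; case: h qE => [|h] qE; first by move: q3; rewrite qE.
have [a aE] : exists a, q = a.+1 by exists q.-1; rewrite prednK // (ltn_trans _ q3).
have -> : (q * q - 1 = a * a + 2 * a)%N by rewrite aE; lia.
by rewrite aE in qE *; rewrite !subn1 /=; nia.
Qed.

Lemma orbits_odd : (3 <= q)%N -> ~~ (2 %| q)%N ->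
  exists o, orbits q A ((q * (q + 1)) %/ 2) = [set o].
Proof.
move=> q3 odd_q.
have [m qm] : exists m, q.+1 = m.*2 by exists (q.+1)./2; move: odd_q; lia.
have -> : ((q * (q + 1)) %/ 2 = q * m)%N.
  by rewrite addn1 qm -muln2 mulnA mulnK.
have nE : torus_exponents 2 q (q * m) (m - 1) (q * m - m).
  by rewrite /torus_exponents; split=> //; nia.
(* Here i + j + 1 = d, so two quadratic monomials suffice. *)
apply: (@orbits_torus 2 _ (m - 1) (q * m - m)
  (fun r => nth 0 [:: 0; 1; 1; 0] r)%N (fun r => nth 0 [:: 1; 0; 0; 1] r)%N) => //.
- move=> i' j' B uB sumB i'0 ij' j'd gcd1.
  have := exponents_odd uB sumB q3 i'0 ij' j'd gcd1 qm erefl.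
  by have : (0 < m <= q * m)%N by [nia]; clear; lia.
- by rewrite !sum_ord4.
by rewrite !sum_ord4 !expoE /=; nia.
Qed.

End Orbits.

(** * The case q = 2 *)

Lemma size_mul_exp (k : fieldType) (c a : {poly k}) n : c != 0 -> a != 0 ->
  size (c * a ^+ n) = ((size c).-1 + (size a).-1 * n).+1.
Proof.
move=> c0 a0; have an0 : a ^+ n != 0 by rewrite expf_neq0.
rewrite size_mul // -size_exp; move: c0 an0; rewrite -!size_poly_gt0.
by move: (size c) (size (a ^+ n)) => x y; lia.
Qed.

Lemma linear_polyE (k : nzRingType) (a : {poly k}) : (size a <= 2)%N ->
  a = (a`_0)%:P + (a`_1)%:P * 'X.
Proof.
move=> sa; apply/polyP => i; rewrite coefD coefC coefCM coefX.
case: i => [|[|i]] /=; rewrite ?mulr0 ?mulr1 ?addr0 ?add0r //.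
by rewrite nth_default // (leq_trans sa).
Qed.

Definition row_poly (k : closedFieldType) (G : 'M[k]_4) d i j r : {poly k} :=
  \sum_c (G r c)%:P * 'X^(expo d i j c).

Lemma row_poly_horner (k : closedFieldType) (G : 'M[k]_4) d i j r t :
  (i <= d)%N -> (j <= d)%N ->
  (row_poly G d i j r).[t] = (G *m monomial_vec d i j (1, t)) r 0.
Proof.
move=> id jd; rewrite horner_sum mxE; apply: eq_bigr => c _.
by rewrite monomial_vecE // mxE /= expr1n mul1r !hornerE.
Qed.

Lemma row_poly_coef (k : closedFieldType) (G : 'M[k]_4) d i j r c :
  (0 < i)%N -> (i < j)%N -> (j < d)%N -> (row_poly G d i j r)`_(expo d i j c) = G r c.
Proof.
move=> i0 ij jd; rewrite coef_sum (bigD1 c) //= coefCM coefXn eqxx mulr1.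
rewrite big1 ?addr0 // => b bc; rewrite coefCM coefXn.
case: eqP => [/(expo_inj i0 ij jd) E|]; last by rewrite mulr0.
by rewrite E eqxx in bc.
Qed.

Lemma row_poly_coef0 (k : closedFieldType) (G : 'M[k]_4) d i j r l :
  (forall c, expo d i j c != l) -> (row_poly G d i j r)`_l = 0.
Proof.
move=> no; rewrite coef_sum big1 // => c _.
by rewrite coefCM coefXn eq_sym (negPf (no c)) mulr0.
Qed.

Lemma row_poly_size (k : closedFieldType) (G : 'M[k]_4) d i j r :
  (i < j)%N -> (j < d)%N -> (size (row_poly G d i j r) <= d.+1)%N.
Proof.
move=> ij jd; apply/leq_sizeP => l dl; apply: row_poly_coef0 => c.
by have := expo_le c ij jd; move: dl; clear; lia.
Qed.

(* With p_r the rows of G (1, X, X^j, X^d), the image satisfies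
   p_0^(d-1) p_3 = p_1^d and p_0^(j-1) p_2 = p_1^j; unique factorization then
   gives p_r = a^(d - e_r) b^(e_r), where (a : b) is p_0 : p_1 in lowest terms. *)
Lemma curve_automorphism (k : closedFieldType) (G : 'M[k]_4) d j :
  (1 < j)%N -> (j < d)%N -> G \in unitmx ->
  (forall t, exists c st, G *m monomial_vec d 1 j (1, t) = c *: monomial_vec d 1 j st) ->
  exists a0 a1 b0 b1, forall r,
    row_poly G d 1 j r = (a0%:P + a1%:P * 'X) ^+ (d - expo d 1 j r)
                       * (b0%:P + b1%:P * 'X) ^+ expo d 1 j r.
Proof.
move=> j1 jd uG img; pose p := row_poly G d 1 j.
have d0 : (0 < d)%N := ltn_trans (ltnW j1) jd.
have jd' := ltnW jd.
have [m dE] : exists m, d = m.+1 by exists d.-1; rewrite prednK.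
have [l jE] : exists l, j = l.+1 by exists j.-1; rewrite prednK // ltnW.
have pE t : exists c s u, forall r, (p r).[t] = c * (s ^+ (d - expo d 1 j r) * u ^+ expo d 1 j r).
  have [c [[s u] E]] := img t; exists c, s, u => r.
  by rewrite row_poly_horner // E monomial_vecE // !mxE.
have rel3 : p o0 ^+ m * p o3 = p o1 ^+ d.
  apply/eqP; rewrite -subr_eq0; apply/eqP; apply: infinite_horner_eq0 => t.
  have [c [s [u E]]] := pE t; rewrite hornerD hornerN hornerM !horner_exp !E !expoE.
  rewrite subnn subn0 dE subn1 /= expr0 expr1 mulr1 mul1r !exprMn -!exprM.
  by rewrite [(m.+1 * m)%N]mulnC [c ^+ m.+1]exprS; ring.
have rel2 : p o0 ^+ l * p o2 = p o1 ^+ j.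
  apply/eqP; rewrite -subr_eq0; apply/eqP; apply: infinite_horner_eq0 => t.
  have [c [s [u E]]] := pE t; rewrite hornerD hornerN hornerM !horner_exp !E !expoE.
  have expE : ((d - 1) * j = d * l + (d - j))%N by rewrite dE jE in jd *; nia.
  rewrite subn0 expr0 mulr1 expr1 !exprMn -!exprM expE exprD.
  have -> : c ^+ j = c * c ^+ l by rewrite jE exprS.
  ring.
have indep (w : 'rV[k]_4) : \sum_r (w 0 r)%:P * p r = 0 -> w = 0.
  move=> w0; rewrite -[w](mulmxK uG) (_ : w *m G = 0) ?mul0mx //.
  apply/rowP => c; rewrite !mxE.
  have /(congr1 (fun f : {poly k} => f`_(expo d 1 j c))) := w0.
  rewrite coef_sum coef0 => E; rewrite -[RHS]E; apply: eq_bigr => r _.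
  by rewrite coefCM row_poly_coef.
have row_neq0 r : p r != 0.
  apply/eqP => r0; have /rowP/(_ r)/eqP : delta_mx 0 r = 0 :> 'rV[k]_4.
    apply: indep; rewrite big1 // => r' _; rewrite mxE eqxx /=.
    by case: eqP => [->|_]; rewrite ?r0 ?mulr0 // mul0r.
  by rewrite !mxE !eqxx oner_eq0.
have not_prop x y : x%:P * p o0 + y%:P * p o1 = 0 -> x = 0.
  move=> xy; pose w : 'rV[k]_4 := \row_r [:: x; y; 0; 0]`_r.
  have /rowP/(_ o0) : w = 0; last by rewrite !mxE.
  by apply: indep; rewrite sum_ord4 !mxE /= !mul0r !addr0.
pose g := gcdp (p o0) (p o1).
have g0 : g != 0 by rewrite gcdp_eq0 negb_and row_neq0.
pose a := p o0 %/ g; pose b := p o1 %/ g.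
have p0E : p o0 = a * g by rewrite divpK // dvdp_gcdl.
have p1E : p o1 = b * g by rewrite divpK // dvdp_gcdr.
have ab : coprimep a b by rewrite coprimep_div_gcd // row_neq0.
have a_neq0 : a != 0 by apply: contraNneq (row_neq0 o0) => a0; rewrite p0E a0 mul0r.
have b_neq0 : b != 0 by apply: contraNneq (row_neq0 o1) => b0; rewrite p1E b0 mul0r.
have abg : a ^+ m * p o3 = b ^+ d * g.
  apply: (mulfI (expf_neq0 m g0)); rewrite mulrA -exprMn [g * a]mulrC -p0E rel3 p1E dE.
  by rewrite !exprMn !exprS; ring.
have [c gE] : exists c, g = c * a ^+ m.
  apply/dvdpP; rewrite -(Gauss_dvdpr _ (coprimep_expl m (coprimep_expr d ab))) -abg.
  by rewrite dvdp_mulr.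
have c_neq0 : c != 0 by apply: contraNneq g0 => c0; rewrite gE c0 mul0r.
have am_neq0 : a ^+ m != 0 := expf_neq0 m a_neq0.
have {}p0E : p o0 = c * a ^+ d by rewrite p0E gE dE exprS; ring.
have {}p1E : p o1 = c * a ^+ m * b by rewrite p1E gE mulrC.
have p3E : p o3 = c * b ^+ d.
  by apply: (mulfI am_neq0); rewrite abg gE; ring.
have p2E : p o2 = c * a ^+ (d - j) * b ^+ j.
  apply: (mulfI (expf_neq0 l (row_neq0 o0))); rewrite rel2 p0E p1E.
  have expE : (m * j = d * l + (d - j))%N by rewrite dE jE in jd *; nia.
  rewrite !exprMn -!exprM expE exprD.
  have -> : c ^+ j = c * c ^+ l by rewrite jE exprS.
  ring.
(* Degree count: deg c + d deg a and deg c + d deg b are at most d. If a and b were both constant,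
   rows 0 and 1 would be proportional; hence one of them is linear and c is constant. *)
have sa : ((size c).-1 + (size a).-1 * d <= d)%N.
  by rewrite -ltnS -size_mul_exp // -p0E row_poly_size.
have sb : ((size c).-1 + (size b).-1 * d <= d)%N.
  by rewrite -ltnS -size_mul_exp // -p3E row_poly_size.
have sab : (2 <= size a)%N || (2 <= size b)%N.
  apply: contraT; rewrite negb_or -!leqNgt => /andP[/size1_polyC aE /size1_polyC bE].
  have a00 : a`_0 != 0 by apply: contraNneq a_neq0 => a00; rewrite aE a00.
  have b00 : b`_0 != 0 by apply: contraNneq b_neq0 => b00; rewrite bE b00.
  case/eqP: b00; apply: (@not_prop _ (- a`_0)); rewrite p0E p1E polyCN -aE -bE dE exprS; ring.
have sc : size c = 1%N.
  by move: c_neq0 sab sa sb; rewrite -size_poly_gt0; nia.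
have sa2 : (size a <= 2)%N by nia.
have sb2 : (size b <= 2)%N by nia.
have [c0 [c0N cE]] : exists c0, c0 != 0 /\ c = c0%:P.
  by have /size_poly1P[c0 ? ?] : size c == 1%N by [apply/eqP]; exists c0.
(* Every p_r is c times a product of d factors a or b, so a d-th root of c can be absorbed into
   both. *)
have [h hE] := closed_expr c0 d0.
exists (h * a`_0), (h * a`_1), (h * b`_0), (h * b`_1).
have lin (f : {poly k}) : (size f <= 2)%N ->
    (h * f`_0)%:P + (h * f`_1)%:P * 'X = h%:P * f.
  by move=> sf; rewrite {3}(linear_polyE sf) !polyCM; ring.
rewrite !lin // {}cE -hE rmorphXn /= in p0E p1E p2E p3E *.
elim/ord4_ind; rewrite -/(p _) ?p0E ?p1E ?p2E ?p3E expoE ?subnn ?subn0 ?subn1 !exprMn.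
- by rewrite !expr0 !mulr1.
- by rewrite !expr1 dE /= exprS; ring.
- by rewrite -{1}(subnK (ltnW jd)) exprD; ring.
by rewrite !expr0 !mul1r.
Qed.

(** This is [segre_form 0 0 l 1], which is singular, completed by the collision 0 + 2 * 2 = 2 + 2 *
    1 special to q = 2. Signs disappear in characteristic 2. *)
Definition cubic_form (k : closedFieldType) (l : k) : 'M[k]_4 :=
  mx4 [:: [:: 0; 0; 1; 0]; [:: 0; l; 0; 1]; [:: 0; 1; 0; 0]; [:: l; 0; 1; 0]].

(** This is [torus_form 1 1] up to signs, with l placed on the extra collision 0 + 2 * 3 = 6 + 2 *
    0, that is q j = d. *)
Definition sextic_form (k : closedFieldType) (l : k) : 'M[k]_4 :=
  mx4 [:: [:: 0; 0; l; 1]; [:: 0; 1; 0; 0]; [:: 1; 0; 0; 0]; [:: l; 0; 1; 0]].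

Section CharacteristicTwo.
Variables (k : closedFieldType) (char2 : 2 \in [pchar k]).

Lemma pnat2 : [pchar k].-nat 2. Proof. by rewrite pnatE. Qed.

Lemma addrr2 (x : k) : x + x = 0.
Proof. by rewrite -mulr2n -mulr_natr (pcharf0 char2) mulr0. Qed.

Lemma cubic_form_cells (l : k) : cell_sums 2 3 1 2 (cubic_form l).
Proof.
move=> v; rewrite !sum_ord4 !mxE /= !if_same !expoE /=.
rewrite [in RHS](_ : 0 = (if 4 == v then 1 + 1 else 0)
  + (if 3 == v then l + l else 0) + (if 7 == v then 1 + 1 else 0) :> k).
  by do 3! case: eqP => _; ring.
by rewrite !addrr2 !if_same !addr0.
Qed.

Lemma sextic_form_cells (l : k) : cell_sums 2 6 1 3 (sextic_form l).
Proof.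
move=> v; rewrite !sum_ord4 !mxE /= !if_same !expoE /=.
rewrite [in RHS](_ : 0 = (if 6 == v then l + l else 0)
  + (if 12 == v then 1 + 1 else 0) + (if 3 == v then 1 + 1 else 0) :> k).
  by do 3! case: eqP => _; ring.
by rewrite !addrr2 !if_same !addr0.
Qed.

Lemma cubic_form_unit (l : k) : l != 0 -> cubic_form l \in unitmx.
Proof.
move=> l0; pose B := mx4
  [:: [:: - l^-1; 0; 0; l^-1]; [:: 0; 0; 1; 0]; [:: 1; 0; 0; 0]; [:: 0; 1; - l; 0]].
have [] // : cubic_form l \in unitmx /\ B \in unitmx.
apply: mulmx1_unit; apply/matrixP; elim/ord4_ind; elim/ord4_ind.
all: by rewrite !mxE !sum_ord4 !mxE /=; field.
Qed.

Lemma sextic_form_unit (l : k) : sextic_form l \in unitmx.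
Proof.
pose B := mx4
  [:: [:: 0; 0; 1; 0]; [:: 0; 1; 0; 0]; [:: 0; 0; - l; 1]; [:: 1; 0; l ^+ 2; - l]].
have [] // : sextic_form l \in unitmx /\ B \in unitmx.
apply: mulmx1_unit; apply/matrixP; elim/ord4_ind; elim/ord4_ind.
all: by rewrite !mxE !sum_ord4 !mxE /=; ring.
Qed.

Lemma sqr_linear2 (x y : k) :
  (x%:P + y%:P * 'X) ^+ 2 = (x ^+ 2)%:P + (y ^+ 2)%:P * 'X^2.
Proof.
rewrite sqrrD mulr2n exprMn !rmorphXn /=.
have -> : x%:P * (y%:P * 'X) + x%:P * (y%:P * 'X) = 0 :> {poly k}.
  by rewrite !mulrA -mulrDl -polyCM -polyCD addrr2 polyC0 mul0r.
by rewrite addr0.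
Qed.

(** A diagonal substitution multiplies l by x^6 y^3, and the hypotheses fix two unit entries. On
    exponents, 3 (6, 3) + (2, 7) = 4 (5, 4). *)
Lemma diagonal_invariant3 (x y : k) :
  x ^+ 5 * y ^+ 4 = 1 -> x ^+ 2 * y ^+ 7 = 1 -> (x ^+ 6 * y ^+ 3) ^+ 3 = 1.
Proof.
move=> X Y; have : (x ^+ 6 * y ^+ 3) ^+ 3 * (x ^+ 2 * y ^+ 7) = (x ^+ 5 * y ^+ 4) ^+ 4.
  by ring.
by rewrite X Y expr1n mulr1.
Qed.

(** All of GL_2 acts on the twisted cubic, so only the entries of the form can force the
    substitution to be diagonal. *)
Lemma cubic_separated (G : 'M[k]_4) (l m : k) : G \in unitmx ->
  (forall t, exists c st, G *m monomial_vec 3 1 2 (1, t) = c *: monomial_vec 3 1 2 st) ->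
  G^T *m cubic_form l *m qpow 2 G = cubic_form m -> l ^+ 3 = m ^+ 3.
Proof.
move=> uG img GE.
have [a0 [a1 [b0 [b1 pE]]]] := curve_automorphism (isT : 1 < 2)%N (isT : 2 < 3)%N uG img.
have coef r c := row_poly_coef G r c (isT : 0 < 1)%N (isT : 1 < 2)%N (isT : 2 < 3)%N.
pose a := a0%:P + a1%:P * 'X; pose b := b0%:P + b1%:P * 'X.
have p0 : row_poly G 3 1 2 o0 = (a0 ^+ 3)%:P + (a0 ^+ 2 * a1)%:P * 'X
    + (a0 * a1 ^+ 2)%:P * 'X^2 + (a1 ^+ 3)%:P * 'X^3.
  rewrite pE expoE subn0 expr0 mulr1 exprS sqr_linear2 ?(rmorphM, rmorphXn) /=; ring.
have p1 : row_poly G 3 1 2 o1 = (a0 ^+ 2 * b0)%:P + (a0 ^+ 2 * b1)%:P * 'X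
    + (a1 ^+ 2 * b0)%:P * 'X^2 + (a1 ^+ 2 * b1)%:P * 'X^3.
  rewrite pE expoE expr1 sqr_linear2 ?(rmorphM, rmorphXn) /=; ring.
have p2 : row_poly G 3 1 2 o2 = (a0 * b0 ^+ 2)%:P + (a1 * b0 ^+ 2)%:P * 'X
    + (a0 * b1 ^+ 2)%:P * 'X^2 + (a1 * b1 ^+ 2)%:P * 'X^3.
  rewrite pE expoE expr1 sqr_linear2 ?(rmorphM, rmorphXn) /=; ring.
have p3 : row_poly G 3 1 2 o3 = (b0 ^+ 3)%:P + (b0 ^+ 2 * b1)%:P * 'X
    + (b0 * b1 ^+ 2)%:P * 'X^2 + (b1 ^+ 3)%:P * 'X^3.
  rewrite pE expoE subnn expr0 mul1r exprS sqr_linear2 ?(rmorphM, rmorphXn) /=; ring.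
have Gentry r x0 x1 x2 x3 :
    row_poly G 3 1 2 r = x0%:P + x1%:P * 'X + x2%:P * 'X^2 + x3%:P * 'X^3 ->
    [/\ G r o0 = x0, G r o1 = x1, G r o2 = x2 & G r o3 = x3].
  move=> E; rewrite -!coef E !expoE !coefD !coefCM !coefX !coefXn !coefC /=.
  by rewrite !mulr0 !mulr1 !addr0 !add0r.
have [G00 G01 G02 G03] := Gentry _ _ _ _ _ p0.
have [G10 G11 G12 G13] := Gentry _ _ _ _ _ p1.
have [G20 G21 G22 G23] := Gentry _ _ _ _ _ p2.
have [G30 G31 G32 G33] := Gentry _ _ _ _ _ p3.
have E r c : G o0 r * G o2 c ^+ 2 + l * (G o1 r * G o1 c ^+ 2) + G o1 r * G o3 c ^+ 2
    + G o2 r * G o1 c ^+ 2 + l * (G o3 r * G o0 c ^+ 2) + G o3 r * G o2 c ^+ 2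
    = cubic_form m r c.
  move/matrixP: GE => /(_ r c); rewrite !mxE sum_ord4 !mxE !sum_ord4 !mxE /= => <-; ring.
(* In characteristic 2 this is the fourth power of the determinant of the substitution. *)
pose K := a0 ^+ 4 * b1 ^+ 4 + a1 ^+ 4 * b0 ^+ 4.
have E02 : a0 * K = 1.
  have := E o0 o2; rewrite G00 G22 G10 G12 G32 G20 G30 G02 !mxE /= => <-.
  (* The other terms of the entry occur twice and cancel in characteristic 2; they are added by hand
     so that [ring] can match both sides. *)
  rewrite -[LHS]addr0 -(addrr2 (l * (a0 ^+ 2 * b0 ^+ 3 * a1 ^+ 4) + a0 ^+ 2 * b0 ^+ 3 * b1 ^+ 4)).
  by rewrite /K; ring.
have E12 : a1 * K = 0.
  have := E o1 o2; rewrite G01 G22 G11 G12 G32 G21 G31 G02 !mxE /= => <-.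
  rewrite -[LHS]addr0
    -(addrr2 (l * (a0 ^+ 2 * b0 ^+ 2 * b1 * a1 ^+ 4) + a0 ^+ 2 * b0 ^+ 2 * b1 ^+ 5)).
  by rewrite /K; ring.
have K0 : K != 0 by apply: contra_eq_neq E02 => ->; rewrite mulr0 eq_sym oner_neq0.
have a10 : a1 = 0 by apply/eqP; move/eqP: E12; rewrite mulf_eq0 (negPf K0) orbF.
have a00 : a0 != 0 by apply: contra_eq_neq E02 => ->; rewrite mul0r eq_sym oner_neq0.
have b10 : b1 != 0.
  by apply: contraNneq K0 => b10; rewrite /K a10 b10 !expr0n /= mulr0 mul0r addr0.
have b00 : b0 = 0.
  have := E o0 o3; rewrite G00 G23 G10 G13 G33 G20 G30 G03 !mxE /= a10 => b00.
  have nz : a0 ^+ 2 * b1 ^+ 6 != 0 by rewrite mulf_neq0 // expf_neq0.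
  apply: (mulIf nz); rewrite mul0r -[RHS]b00; ring.
have Y : a0 ^+ 2 * b1 ^+ 7 = 1.
  have := E o1 o3; rewrite G01 G23 G11 G13 G33 G21 G31 G03 !mxE /= a10 b00 => <-; ring.
have Z : a0 ^+ 6 * b1 ^+ 3 * l = m.
  have := E o1 o1; rewrite G01 G21 G11 G31 !mxE /= a10 b00 => <-; ring.
have X : a0 ^+ 5 * b1 ^+ 4 = 1 by rewrite -E02 /K a10; ring.
by rewrite -Z exprMn (diagonal_invariant3 X Y) mul1r.
Qed.

(** Unlike for the cubic, the degrees 2, 4 and 5 are missing from the monomials, and this makes the
    substitution diagonal before l is compared. *)
Lemma sextic_separated (G : 'M[k]_4) (l m : k) : G \in unitmx ->
  (forall t, exists c st, G *m monomial_vec 6 1 3 (1, t) = c *: monomial_vec 6 1 3 st) ->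
  G^T *m sextic_form l *m qpow 2 G = sextic_form m -> l ^+ 3 = m ^+ 3.
Proof.
move=> uG img GE.
have [a0 [a1 [b0 [b1 pE]]]] := curve_automorphism (isT : 1 < 3)%N (isT : 3 < 6)%N uG img.
have coef r c := row_poly_coef G r c (isT : 0 < 1)%N (isT : 1 < 3)%N (isT : 3 < 6)%N.
have coef0 r n : n \in [:: 2; 4; 5]%N -> (row_poly G 6 1 3 r)`_n = 0.
  move=> nE; apply: row_poly_coef0 => c; apply: contraL nE => /eqP <-.
  by elim/ord4_ind: c.
have E r c : l * (G o0 r * G o2 c ^+ 2) + G o0 r * G o3 c ^+ 2 + G o1 r * G o1 c ^+ 2
    + G o2 r * G o0 c ^+ 2 + l * (G o3 r * G o0 c ^+ 2) + G o3 r * G o2 c ^+ 2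
    = sextic_form m r c.
  move/matrixP: GE => /(_ r c); rewrite !mxE sum_ord4 !mxE !sum_ord4 !mxE /= => <-; ring.
have E03 := E o0 o3; rewrite [sextic_form m o0 o3]mxE /= in E03.
have sixth (x y : k) : ((x%:P + y%:P * 'X) ^+ 6)`_2 = x ^+ 4 * y ^+ 2.
  rewrite (exprM _ 2 3) sqr_linear2.
  have -> : ((x ^+ 2)%:P + (y ^+ 2)%:P * 'X^2) ^+ 3
    = (x ^+ 6)%:P + (3 * x ^+ 4 * y ^+ 2)%:P * 'X^2 + (3 * x ^+ 2 * y ^+ 4)%:P * 'X^4
      + (y ^+ 6)%:P * 'X^6.
    by rewrite ?(rmorphM, rmorphXn, rmorph_nat) /=; ring.
  rewrite !coefD !coefCM !coefXn !coefC /= !mulr0 !mulr1 !addr0 add0r.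
  by rewrite -[RHS]addr0 -(addrr2 (x ^+ 4 * y ^+ 2)); ring.
have a01 : (a0 == 0) || (a1 == 0).
  have := coef0 o0 2 isT; rewrite pE expoE subn0 expr0 mulr1 sixth => /eqP.
  by rewrite mulf_eq0 (expf_eq0 _ 4) (expf_eq0 _ 2).
have b01 : (b0 == 0) || (b1 == 0).
  have := coef0 o3 2 isT; rewrite pE expoE subnn expr0 mul1r sixth => /eqP.
  by rewrite mulf_eq0 (expf_eq0 _ 4) (expf_eq0 _ 2).
have not_const : ~ (a1 = 0 /\ b1 = 0).
  case=> a10 b10; have G3 r : G r o3 = 0.
    rewrite -coef pE a10 b10 polyC0 !mul0r !addr0 -!rmorphXn -rmorphM /= coefC.
    by rewrite expoE.
  by move/eqP: E03; rewrite !G3 !expr0n /= !mulr0 !addr0 eq_sym oner_eq0.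
have not_infty : ~ (a0 = 0 /\ b0 = 0).
  case=> a00 b00; have G0 r : G r o0 = 0.
    rewrite -coef pE a00 b00 polyC0 !add0r !exprMn mulrACA -exprD expoE.
    rewrite -!rmorphXn -rmorphM /= coefCM coefXn subnK; first by rewrite mulr0.
    by elim/ord4_ind: r.
  by move/eqP: E03; rewrite !G0 !mul0r !mulr0 !addr0 eq_sym oner_eq0.
(* An antidiagonal substitution is excluded by the coefficient of degree 5 in a^5 b: reversal does
   not preserve the exponents 0, 1, 3, 6. *)
have [a10 b00] : a1 = 0 /\ b0 = 0.
  case/orP: a01 => /eqP a; case/orP: b01 => /eqP b //.
  - by case: not_infty.
  - have := coef0 o1 5 isT; rewrite pE expoE expr1 a b polyC0 mul0r add0r addr0.
    rewrite exprMn -rmorphXn /= mulrAC coefMXn /= -rmorphM coefC /= => /eqP.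
    rewrite mulf_eq0 expf_eq0 /= => /orP[]/eqP z.
      by case: not_const.
    by case: not_infty.
  by case: not_const.
have Gdiag r c : G r c = a0 ^+ (6 - expo 6 1 3 r) * b1 ^+ expo 6 1 3 r * (r == c)%:R.
  rewrite -coef pE a10 b00 polyC0 mul0r addr0 add0r exprMn mulrA -!rmorphXn -rmorphM /=.
  rewrite coefCM coefXn; congr (_ * _).
  have inj := @expo_inj 6 1 3 isT isT isT.
  by rewrite (inj_eq inj) eq_sym.
have X : a0 ^+ 6 * b1 ^+ 12 = 1 by rewrite -[RHS]E03 !Gdiag !expoE /=; ring.
have Y : a0 ^+ 15 * b1 ^+ 3 = 1.
  by have := E o1 o1; rewrite !Gdiag !expoE !mxE /= => <-; ring.
have Z : a0 ^+ 12 * b1 ^+ 6 * l = m.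
  by have := E o0 o2; rewrite !Gdiag !expoE !mxE /= => <-; ring.
have W : (a0 ^+ 12 * b1 ^+ 6) ^+ 3 = (a0 ^+ 6 * b1 ^+ 12) * (a0 ^+ 15 * b1 ^+ 3) ^+ 2.
  by ring.
by rewrite -Z exprMn W X Y expr1n mulr1 mul1r.
Qed.

End CharacteristicTwo.

Lemma infinite_nonzero (k : closedFieldType) : infinite_set [set x : k | x != 0].
Proof.
move=> /finite_seqP[s sE]; pose p : {poly k} := 'X * \prod_(a <- s) ('X - a%:P).
have /eqP : p = 0.
  apply: infinite_horner_eq0 => x; apply/eqP; rewrite hornerM hornerX mulf_eq0.
  have [//|x0] := eqVneq x 0; rewrite -rootE root_prod_XsubC /=.
  by have : [set` s] x by rewrite -sE.
by rewrite mulf_eq0 polyX_eq0 /= (negPf (monic_neq0 (monic_prod_XsubC _ _ _))).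
Qed.

Section InfiniteOrbits.
Variables (k : closedFieldType) (A : 'M[k]_4).
Hypotheses (char2 : 2 \in [pchar k]) (A_unit : A \in unitmx).

Lemma curve_eq_reparam (F F' : 'M[k]_4) d i j : F \in unitmx ->
  C_ F d i j = C_ F' d i j ->
  forall t, exists c st, invmx F *m F' *m monomial_vec d i j (1, t) = c *: monomial_vec d i j st.
Proof.
move=> uF FF' t.
have : C_ F d i j <[F' *m monomial_vec d i j (1, t)]>%VS.
  by rewrite FF'; exists (1, t) => //=; rewrite xpair_eqE oner_eq0.
case=> st st0 lineE.
have : F' *m monomial_vec d i j (1, t) \in <[F *m monomial_vec d i j st]>%VS.
  by rewrite lineE memv_line.
move=> /vlineP[c cE]; exists c, st.
by rewrite -mulmxA cE -scalemxAr mulKmx.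
Qed.

(** Different l may share an orbit, but l^3 is a function of the orbit. As cubing is onto, finitely
    many orbits would leave finitely many nonzero scalars. *)
Lemma orbits_infinite d j (form : k -> 'M[k]_4) : (1 < j)%N -> (j < d)%N ->
  (forall l, l != 0 -> form l \in unitmx) ->
  (forall l, cell_sums 2 d 1 j (form l)) ->
  (forall G l m, G \in unitmx ->
     (forall t, exists c st, G *m monomial_vec d 1 j (1, t) = c *: monomial_vec d 1 j st) ->
     G^T *m form l *m qpow 2 G = form m -> l ^+ 3 = m ^+ 3) ->
  infinite_set (orbits 2 A d).
Proof.
move=> j1 jd uform cells sep fin; have p2 := pnat2 char2.
have /choice[F FP] : forall l, exists F, l != 0 -> F \in unitmx /\ pullback 2 A F = form l.
  move=> l; have [->|l0] := eqVneq l 0; first by exists 0.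
  have [F uF FE] := qform_congruent p2 isT A_unit (uform _ l0).
  by exists F.
pose O l := orbit_ 2 A (C_ (F l) d 1 j).
have OT l : l != 0 -> orbits 2 A d (O l).
  move=> l0; have [uF FE] := FP _ l0; exists (C_ (F l) d 1 j) => //.
  apply: (@T_nonempty _ _ p2 _ _ _ _ _ (fun r => r == o0) (fun r => r == o1)) => //.
  - by rewrite FE.
  - by rewrite !sum_ord4.
  by rewrite !sum_ord4 !expoE.
have O_inj l m : l != 0 -> m != 0 -> O l = O m -> l ^+ 3 = m ^+ 3.
  move=> l0 m0 lm; have [uFl FlE] := FP _ l0; have [uFm FmE] := FP _ m0.
  have : O m (C_ (F m) d 1 j).
    exists (scalar_coset 1%:M); last by rewrite act_C mul1mx.
    exists 1%:M => //=; split; first exact: unitmx1.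
    by exists 1; rewrite ?oner_neq0 // trmx1 mul1mx (qpow1 p2) mulmx1 scale1r.
  rewrite -lm => -[_ [P [uP [c c0 PE]] <-]]; rewrite act_C => CE.
  (* As q + 1 = 3, scaling P by h multiplies its multiplier c by h^3. So P can be taken to preserve
     A exactly, without changing its action on curves. *)
  have [h hE] := @closed_expr k 3 c^-1 isT.
  have h0 : h != 0.
    by apply/eqP => h0; move/eqP: hE; rewrite h0 expr0n eq_sym invr_eq0 (negPf c0).
  pose F1 := h *: P *m F l.
  have uF1 : F1 \in unitmx by rewrite unitmx_mul unitmxZ ?unitfE // uP.
  have F1E : pullback 2 A F1 = form l.
    have hP : pullback 2 A (h *: P) = A.
      rewrite /pullback linearZ (qpowZ p2) /= -!scalemxAl -scalemxAr PE !scalerA.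
      by rewrite -exprS hE mulVf // scale1r.
    by rewrite (pullbackM p2) hP -FlE.
  have CE1 : C_ F1 d 1 j = C_ (F m) d 1 j.
    rewrite -CE /F1 -scalemxAl -mul_mx_scalar.
    apply: (@reparametrize _ _ _ _ _ _ _ _ _ id id) => st st0; split=> //.
    by exists h; rewrite // mul_scalar_mx.
  apply: (sep (invmx F1 *m F m)).
  - by rewrite unitmx_mul unitmx_inv uF1.
  - exact: curve_eq_reparam.
  by rewrite -F1E -(pullbackM p2) mulKVmx // FmE.
apply: (@infinite_nonzero k).
(* This recovers l^3 from the orbit; the default 0 serves only orbits outside the family. *)
pose inv o : k := xget 0 [set c | exists2 l, l != 0 & c = l ^+ 3 /\ o = O l].
apply: sub_finite_set (finite_image inv fin) => c /= c0.
have [l lE] := @closed_expr k 3 c isT.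
have l0 : l != 0 by apply: contraNneq c0 => l0; rewrite -lE l0 expr0n.
exists (O l); first exact: OT.
rewrite /inv; case: xgetP => [x -> [m m0 [-> /esym E]]|/(_ c) []].
  by rewrite -lE; apply: O_inj.
by exists l.
Qed.

End InfiniteOrbits.

Theorem theorem1p2 (q p n : nat) (p_prime : prime p) (n_gt0 : (0 < n)%N)
    (qE : q = (p ^ n)%N)
    (Fq2 : finFieldType) (card_Fq2 : #|Fq2| = (q ^ 2)%N)
    (k : closedFieldType) (iota : {rmorphism Fq2 -> k})
    (k_algebraic : forall x : k, algebraicOver iota x)
    (A : 'M[k]_4) (A_unit : A \in unitmx) :
  [/\ (forall d : nat,
         [\/ d = (q + 1)%N,
             (2 %| q)%N /\ d = (q * (q + 1))%N
           | ~~ (2 %| q)%N /\ d = ((q * (q + 1)) %/ 2)%N] ->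
         (q = 2%N -> infinite_set (orbits q A d)) /\
         ((3 <= q)%N -> orbits q A d #= `I_1)),
      ((3 <= q)%N ->
         orbits q A (q + 1)%N #= [set ((0, 0) : k * k)]),
      ((3 <= q)%N -> (2 %| q)%N ->
         orbits q A (q * (q + 1))%N #= [set (0 : k)])
    & ((3 <= q)%N -> ~~ (2 %| q)%N ->
         orbits q A ((q * (q + 1)) %/ 2)%N #= [set (0 : k)])].
Proof.
have charp : p \in [pchar k].
  have card_p : #|Fq2| = (p ^ (n * 2))%N by rewrite card_Fq2 qE expnM.
  by rewrite (fmorph_pchar iota) (card_finPcharP card_p).
have pq : [pchar k].-nat q by rewrite qE pnatX pnatE // charp.
split=> [d d_cases|q3|q3 even_q|q3 odd_q].
- split=> [q2|q3].
    have char2 : 2 \in [pchar k] by move: pq; rewrite q2 pnatE.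
    rewrite q2 in d_cases *; case: d_cases => [->|[_ ->]|[//]].
      apply: (orbits_infinite char2 A_unit _ _ _ (@cubic_form_cells k char2)) => //.
        exact: cubic_form_unit.
      exact: cubic_separated.
    apply: (orbits_infinite char2 A_unit _ _ _ (@sextic_form_cells k char2)) => //.
      by move=> l _; apply: sextic_form_unit.
    exact: sextic_separated.
  case: d_cases => [->|[even_q ->]|[odd_q ->]].
  + by have [o ->] := orbits_segre pq A_unit q3; apply: card_set1.
  + by have [o ->] := orbits_even pq A_unit q3 even_q; apply: card_set1.
  by have [o ->] := orbits_odd pq A_unit q3 odd_q; apply: card_set1.
- by have [o ->] := orbits_segre pq A_unit q3; apply: eq_card1.
- by have [o ->] := orbits_even pq A_unit q3 even_q; apply: eq_card1.
by have [o ->] := orbits_odd pq A_unit q3 odd_q; apply: eq_card1.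
Qed.
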